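(* Let $d\geq1$ be an integer, $\alpha>\frac d2$ and $b>0$. As $\beta$ tends to $\alpha$ and $a$ and $\gamma$ tend to infinity in such a way that $(\alpha,\beta,\gamma)\in\mathcal P_d$ and $\frac a{\sqrt\gamma}$ tends to $b$, the Gauss hypergeometric covariance $G_d(\cdot;a,\alpha,\beta,\gamma)$ converges uniformly on $\mathbb{R}^d$ to the Gaussian covariance with scale factor $b$, namely $\boldsymbol h\mapsto\exp\left(-\frac{\|\boldsymbol h\|^2}{b^2}\right)$. The same result holds by interchanging $\beta$ and $\gamma$.
   Context: $\mathcal P_d$ is the set of triplets $(\alpha,\beta,\gamma)$ of positive reals with $\alpha>\frac d2$, $2(\beta-\alpha)(\gamma-\alpha)\geq\alpha$ and $2(\beta+\gamma)\geq6\alpha+1$ (these imply $\beta>\alpha$, $\gamma>\alpha$). For $a>0$ and $(\alpha,\beta,\gamma)\in\mathcal P_d$, the Gauss hypergeometric covariance is $$G_d(\boldsymbol h;a,\alpha,\beta,\gamma)=\frac{\Gamma(\beta-\frac d2)\Gamma(\gamma-\frac d2)}{\Gamma(\beta-\alpha+\gamma-\frac d2)\Gamma(\alpha-\frac d2)}\left(1-\frac{\|\boldsymbol h\|^2}{a^2}\right)_+^{\beta-\alpha+\gamma-\frac d2-1}{}_2F_1\left(\beta-\alpha,\gamma-\alpha;\beta-\alpha+\gamma-\tfrac d2;\left(1-\tfrac{\|\boldsymbol h\|^2}{a^2}\right)_+\right),\quad\boldsymbol h\in\mathbb{R}^d,$$ where $(x)_+=\max\{x,0\}$ and ${}_2F_1$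 is the Gauss hypergeometric function. *)

(* Defs.v *)
From HB Require Import structures.
From mathcomp Require Import all_boot all_order all_algebra.
From mathcomp Require Import all_classical all_reals all_analysis.

Set Implicit Arguments.
Unset Strict Implicit.
Unset Printing Implicit Defensive.

Import Order.TTheory GRing.Theory Num.Theory.
Import numFieldNormedType.Exports.

Local Open Scope classical_set_scope.
Local Open Scope ring_scope.

(* Euler's integral; it diverges for x <= 0, where the value is meaningless. *)
Definition Gamma {R : realType} (x : R) : R :=
  \int[lebesgue_measure]_(t in `]0, +oo[) (t `^ (x - 1) * expR (- t)).

Definition pochhammer {R : realType} (x : R) (n : nat) : R :=
  \prod_(i < n) (x + i%:R).

Definition hyp2F1_coeff {R : realType} (u v w z : R) (n : nat) : R :=
  pochhammer u n * pochhammer v n / pochhammer w n * (z ^+ n / n`!%:R).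

(* The sum of the Gauss series. For u, v, w > 0 with w - u - v > 0 the series
   converges on the closed interval [0, 1], so no continuation is needed at
   z = 1; in gauss_hyp_cov, w - u - v = alpha - d / 2. *)
Definition hyp2F1 {R : realType} (u v w z : R) : R :=
  limn (series (hyp2F1_coeff u v w z)).

(* The norm `|h| of the library on 'rV[R]_d is the sup norm. *)
Definition euclid_norm {R : realType} {d : nat} (h : 'rV[R]_d) : R :=
  Num.sqrt (\sum_(i < d) h ord0 i ^+ 2).

Definition pos_part {R : realType} (x : R) : R := Num.max x 0.

Definition hyp_params {R : realType} (d : nat) (alpha beta gamma : R) : Prop :=
  [/\ [/\ 0 < alpha, 0 < beta & 0 < gamma],
      d%:R / 2 < alpha,
      alpha <= 2 * (beta - alpha) * (gamma - alpha)
    & 6 * alpha + 1 <= 2 * (beta + gamma)].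

(* For parameters in hyp_params the exponent of the power is positive, so the
   covariance vanishes outside the ball of radius a (0 `^ x = 0 for x > 0). *)
Definition gauss_hyp_cov {R : realType} (d : nat) (a alpha beta gamma : R)
    (h : 'rV[R]_d) : R :=
  let d2 := d%:R / 2 in
  let z := pos_part (1 - euclid_norm h ^+ 2 / a ^+ 2) in
  Gamma (beta - d2) * Gamma (gamma - d2)
    / (Gamma (beta - alpha + gamma - d2) * Gamma (alpha - d2))
  * z `^ (beta - alpha + gamma - d2 - 1)
  * hyp2F1 (beta - alpha) (gamma - alpha) (beta - alpha + gamma - d2) z.

Definition gaussian_cov {R : realType} (d : nat) (b : R) (h : 'rV[R]_d) : R :=
  expR (- (euclid_norm h ^+ 2 / b ^+ 2)).

Arguments gauss_hyp_cov {R} d a alpha beta gamma h.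
Arguments gaussian_cov {R} d b h.

(* Main.v *)
(* Put u = beta - alpha, v = gamma - alpha, s = alpha - d / 2. By Gauss's
   summation theorem the prefactor of the covariance is 1 / 2F1(u, v; u+v+s; 1),
   so that G = z^p Q with Q = 2F1(z) / 2F1(1) in [0, 1]. Although 2F1(1) may blow
   up in the limit, Q tends to 1: by 1 - z^n <= (n (1 - z))^k and
   (u)_n n^k <= (2 u / k) (u+k)_n, with 0 < k < s, the difference 2F1(1) - 2F1(z)
   is at most (2 u / k) (1 - z)^k 2F1(u+k, v; u+v+s; 1), and a second use of
   Gauss's theorem gives 1 - Q <= C u ((1 - z) gamma)^k, where (1 - z) gamma stays
   bounded on bounded sets of h while u tends to 0. The factor z^p is compared
   with the Gaussian through exp(- p y / (1 - y)) <= (1 - y)^p <= exp(- p y).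
   Gauss's theorem is obtained from the contiguous relation s -> s + 1, iterated
   to infinity, where Gamma(p + s) ~ Gamma(p) p^s. *)

Require Import Defs.
From HB Require Import structures.
From mathcomp Require Import all_boot all_order all_algebra.
From mathcomp Require Import all_classical all_reals all_analysis.
From mathcomp Require Import measurable_realfun ring lra.

Set Implicit Arguments.
Unset Strict Implicit.
Unset Printing Implicit Defensive.

Import Order.TTheory GRing.Theory Num.Theory.
Import numFieldNormedType.Exports.

Local Open Scope classical_set_scope.
Local Open Scope ring_scope.

(** * Euler's integral *)

(** Both ends are improper. The fundamental theorem on the closed rays [1 / (n + 1), +oo[ is
    combined with monotone convergence as these rays exhaust ]0, +oo[; the sign of [f] serves the
    latter. *)
Lemma ge0_FTC2_0y {R : realType} (f F : R -> R) (l0 l : R) :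
  (forall x : R, 0 < x -> 0 <= f x) ->
  (forall x : R, 0 < x -> {for x, continuous f}) ->
  (forall x : R, 0 < x -> is_derive x 1 F (f x)) ->
  F x @[x --> 0^'+] --> l0 -> F x @[x --> +oo] --> l ->
  (\int[lebesgue_measure]_(x in `]0%R, +oo[) (f x)%:E = l%:E - l0%:E)%E.
Proof.
move=> f0 cf dF F0 Fy.
pose A (n : nat) : set R := `[harmonic n, +oo[%classic.
have hn n : 0 < harmonic n :> R by exact: harmonic_gt0.
have AE : `]0, +oo[%classic = \bigcup_n A n.
  apply/seteqP; split=> x /=; rewrite in_itv/= andbT.
    move=> x0.
    have : \forall n \near \oo, harmonic n < x.
      by have := @cvg_harmonic R; move/(cvgr_lt 0); apply.
    case=> N _ /(_ N (leqnn N)) /ltW hx.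
    by exists N => //; rewrite /A /= in_itv/= andbT.
  case=> n _; rewrite /A /= in_itv/= andbT => h.
  exact: lt_le_trans (hn n) h.
have dFx (x : R) : 0 < x -> derivable F x 1 by move=> /dF [].
have cF (x : R) : 0 < x -> {for x, continuous F}.
  by move=> /dFx; move/derivable1_diffP/differentiable_continuous.
have Aint n : (\int[lebesgue_measure]_(x in A n) (f x)%:E
               = l%:E - (F (harmonic n))%:E)%E.
  apply: ge0_continuous_FTC2y => //.
  - by move=> x hx; apply: f0; exact: lt_le_trans (hn n) hx.
  - apply/continuous_within_itvcyP; split.
      move=> x; rewrite in_itv/= andbT => hx; apply: cf.
      exact: lt_trans (hn n) hx.
    by apply: cvg_at_right_filter; exact: cf.
  - by move=> x hx; apply: dFx; exact: lt_trans (hn n) hx.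
  - by apply: cvg_at_right_filter; exact: cF.
  - move=> x; rewrite in_itv/= andbT => hx; rewrite derive1E.
    by have [_ ->] := dF x (lt_trans (hn n) hx).
have mf : measurable_fun (`]0, +oo[%classic : set R) f.
  apply: open_continuous_measurable_fun => //.
  by move=> x; rewrite inE/= in_itv/= andbT => /cf.
rewrite AE.
have c1 : (\int[lebesgue_measure]_(x in A n) (f x)%:E @[n --> \oo] -->
   \int[lebesgue_measure]_(x in \bigcup_n A n) (f x)%:E)%E.
  apply: ge0_nondecreasing_set_cvg_integral.
  - move=> m n mn; rewrite subsetEset => x; rewrite /A /= !in_itv/= !andbT.
    by apply: le_trans; rewrite lef_pV2 ?posrE// ler_nat ltnS.
  - by move=> n; exact: measurable_itv.
  - move=> n; apply/measurable_EFinP; apply: measurable_funS mf => //.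
    by rewrite AE; exact: bigcup_sup.
  - move=> n x; rewrite /A /= in_itv/= andbT => hx.
    by rewrite lee_fin f0//; exact: lt_le_trans (hn n) hx.
have c2 : ((l - F (harmonic n))%:E @[n --> \oo] --> (l - l0)%:E)%E.
  apply: cvg_EFin; first exact: nearW.
  apply: cvgB; first exact: cvg_cst.
  move/cvg_at_rightP : F0; apply; split => //.
  exact: cvg_harmonic.
rewrite -EFinB; apply: (cvg_unique _ c1) => //.
rewrite (_ : (fun n => _) = fun n => (l - F (harmonic n))%:E) //.
by apply/funext => n; exact: Aint.
Qed.

Lemma cvg_invr_pinfty {R : realType} : t^-1 @[t --> +oo] --> (0 : R).
Proof.
have t0 : \forall t \near +oo, 0 < (t : R) by exact: nbhs_pinfty_gt.
exact/(gtr0_cvgV0 t0)/cvg_id.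
Qed.

Lemma ln_le_sub1 {R : realType} (y : R) : 0 < y -> ln y <= y - 1.
Proof.
move=> y0; have := @le_ln1Dx R (y - 1).
by rewrite (_ : 1 + (y - 1) = y); [apply; lra|ring].
Qed.

Definition Gamma_integrand {R : realType} (x t : R) : R :=
  t `^ (x - 1) * expR (- t).

Lemma Gamma_integrand_ge0 {R : realType} (x t : R) : 0 <= Gamma_integrand x t.
Proof. by rewrite mulr_ge0 ?powR_ge0 ?expR_ge0. Qed.

Lemma measurable_Gamma_integrand {R : realType} (x : R) (D : set R) :
  measurable D -> measurable_fun D (Gamma_integrand x).
Proof.
move=> mD; apply: (@measurable_funS _ _ _ _ setT) => //.
apply: measurable_funM; first exact: measurable_powR.
by apply: measurableT_comp; [exact: measurable_expR|exact: oppr_measurable].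
Qed.

(* The derivative of this bounded function dominates t^(x-1) e^-t up to a constant
   on the whole of ]0, +oo[, at both ends at once. *)
Definition dominating_primitive {R : realType} (x t : R) : R :=
  (t * (1 + t)^-1) `^ x.

Definition dominating_density {R : realType} (x t : R) : R :=
  x * (t * (1 + t)^-1) `^ (x - 1) * (1 + t) ^- 2.

Lemma is_derive_dominating {R : realType} (x t : R) : 0 < t ->
  is_derive t 1 (dominating_primitive x) (dominating_density x t).
Proof.
move=> t0; have t1 : 1 + t != 0 by rewrite gt_eqF//; lra.
have h : 0 < t * (1 + t)^-1 by rewrite mulr_gt0// invr_gt0; lra.
have D1 : is_derive t 1 (fun t : R => 1 + t) 1.
  by have := is_deriveD (is_derive_cst (1 : R) t 1) (is_derive_id t 1);
    rewrite add0r.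
have D2 := is_deriveM (is_derive_id t 1) (is_deriveV t1 D1).
have := is_derive1_comp (f := fun u : R => u `^ x)
  (g := fun u : R => u * (1 + u)^-1) (is_derive1_powR x h) D2.
rewrite /comp /dominating_primitive /= => D3; apply: is_derive_eq D3 _.
rewrite /dominating_density /=; congr (_ * _).
by rewrite /GRing.scale/=; field.
Qed.

Lemma dominating_density_ge0 {R : realType} (x t : R) : 0 < x -> 0 < t ->
  0 <= dominating_density x t.
Proof.
move=> x0 t0; rewrite /dominating_density !mulr_ge0 ?powR_ge0 ?(ltW x0)//.
by rewrite invr_ge0 exprn_ge0//; lra.
Qed.

Lemma continuous_dominating_density {R : realType} (x t : R) : 0 < t ->
  {for t, continuous (dominating_density x)}.
Proof.
move=> t0; have t1 : 1 + t != 0 by rewrite gt_eqF//; lra.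
have h : 0 < t * (1 + t)^-1 by rewrite mulr_gt0// invr_gt0; lra.
have c1 : {for t, continuous (fun t : R => 1 + t)}.
  by apply: cvgD; [exact: cvg_cst|exact: cvg_id].
have c2 : {for t, continuous (fun t : R => (1 + t)^-1)} by exact: cvgV.
have c3 : {for t, continuous (fun t : R => t * (1 + t)^-1)}.
  by apply: cvgM => //; exact: cvg_id.
have c4 : {for t, continuous (fun t : R => (t * (1 + t)^-1) `^ (x - 1))}.
  apply: (@continuous_comp _ _ _ (fun t : R => t * (1 + t)^-1)
    (fun u : R => u `^ (x - 1))) => //.
  apply/differentiable_continuous/derivable1_diffP/derivable_powR.
  by rewrite in_itv/= h.
have c5 : {for t, continuous (fun t : R => (1 + t) ^- 2)}.
  rewrite (_ : (fun t : R => _) = fun t => (1 + t)^-1 * (1 + t)^-1).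
    exact: (cvgM c2 c2).
  by apply/funext => y; rewrite expr2 invfM.
exact: (cvgM (cvgM (cvg_cst x) c4) c5).
Qed.

Lemma dominating_primitive_cvg0 {R : realType} (x : R) : 0 < x ->
  dominating_primitive x t @[t --> 0^'+] --> (0 : R).
Proof.
move=> x0; apply: (@squeeze_cvgr _ _ _ _ (cst 0) (fun u : R => u `^ x)).
- near=> t; have t0 : 0 < t by near: t; exact: nbhs_right_gt.
  rewrite powR_ge0/= ge0_ler_powR ?nnegrE ?(ltW x0) ?(ltW t0)//.
    by rewrite mulr_ge0 ?invr_ge0; lra.
  by rewrite ler_pdivrMr; nra.
- exact: cvg_cst.
- exact: powR_cvg0.
Unshelve. all: by end_near. Qed.

Lemma dominating_primitive_cvgy {R : realType} (x : R) : 0 < x ->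
  dominating_primitive x t @[t --> +oo] --> (1 : R).
Proof.
move=> x0.
have H : t * (1 + t)^-1 @[t --> +oo] --> (1 : R).
  have : (1 + t^-1)^-1 @[t --> +oo] --> ((1 + 0)^-1 : R).
    apply: cvgV; first by rewrite addr0 oner_neq0.
    by apply: cvgD; [exact: cvg_cst|exact: cvg_invr_pinfty].
  rewrite addr0 invr1; apply: cvg_trans; apply: near_eq_cvg; near=> t.
  have t0 : 0 < t by near: t; exact: nbhs_pinfty_gt.
  by field; rewrite ?gt_eqF//=; lra.
have cp : {for (1 : R), continuous (fun u : R => u `^ x)}.
  apply/differentiable_continuous/derivable1_diffP/derivable_powR.
  by rewrite in_itv/= ltr01.
by have := cvg_comp _ (fun u : R => u `^ x) H cp; rewrite powR1.
Unshelve. all: by end_near. Qed.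

Lemma integral_dominating_density {R : realType} (x : R) : 0 < x ->
  (\int[lebesgue_measure]_(t in `]0%R, +oo[) (dominating_density x t)%:E = 1)%E.
Proof.
move=> x0; transitivity ((1 : R)%:E - (0 : R)%:E)%E; last by rewrite sube0.
apply: (@ge0_FTC2_0y _ _ (dominating_primitive x)).
- by move=> t t0; exact: dominating_density_ge0.
- by move=> t; exact: continuous_dominating_density.
- by move=> t; exact: is_derive_dominating.
- exact: dominating_primitive_cvg0.
- exact: dominating_primitive_cvgy.
Qed.

(** Once t^(x - 1) is cancelled, the claim is that (1 + t)^(x + 1) e^(-t) is bounded. This is ln y
    <= y - 1 at y = (1 + t) / p with p = x + 1; the [/ x] in the constant cancels the factor [x] of
    the density. *)
Lemma Gamma_integrand_dominated {R : realType} (x : R) : 0 < x ->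
  exists2 K : R, 0 < K & forall t, 0 < t ->
    Gamma_integrand x t <= K * dominating_density x t.
Proof.
move=> x0; pose p := x + 1; have p0 : 0 < p by rewrite /p; lra.
exists (expR (1 + p * ln p) / x); first by rewrite divr_gt0// expR_gt0.
move=> t t0; have t1 : 0 < 1 + t by lra.
have key : p * ln (1 + t) <= t + (1 + p * ln p).
  have : ln ((1 + t) / p) <= (1 + t) / p - 1.
    by apply: ln_le_sub1; rewrite divr_gt0.
  rewrite ln_div ?posrE// -(ler_pM2l p0) => h.
  have e : p * ((1 + t) / p - 1) = 1 + t - p by field; rewrite gt_eqF.
  by move: h; rewrite e mulrBr; nra.
have key2 : (1 + t) `^ p * expR (- t) <= expR (1 + p * ln p).
  by rewrite /powR gt_eqF// -expRD ler_expR; lra.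
rewrite /Gamma_integrand /dominating_density.
rewrite powRM ?invr_ge0 ?(ltW t0) ?(ltW t1)//.
have -> : expR (1 + p * ln p) / x *
    (x * (t `^ (x - 1) * (1 + t)^-1 `^ (x - 1)) * (1 + t) ^- 2)
  = t `^ (x - 1) * (expR (1 + p * ln p) *
     ((1 + t)^-1 `^ (x - 1) * (1 + t) ^- 2)).
  by field; rewrite !gt_eqF.
apply: ler_wpM2l; first exact: powR_ge0.
have -> : (1 + t)^-1 `^ (x - 1) * (1 + t) ^- 2 = ((1 + t) `^ p)^-1.
  rewrite -[X in X `^ (x - 1)]powR_inv1 ?(ltW t1)// -powRrM.
  rewrite -powR_invn ?(ltW t1)// -powRD; last by apply/implyP => _;
    rewrite gt_eqF.
  by rewrite -powRN; congr (_ `^ _); rewrite /p; ring.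
by rewrite ler_pdivlMr ?powR_gt0// mulrC.
Qed.

Lemma integrable_dominating_density {R : realType} (x : R) : 0 < x ->
  lebesgue_measure.-integrable `]0%R, +oo[ (EFin \o dominating_density x).
Proof.
move=> x0; apply/integrableP; split.
  apply/measurable_EFinP.
  apply: open_continuous_measurable_fun => // t.
  by rewrite inE/= in_itv/= andbT; exact: continuous_dominating_density.
under eq_integral => t.
  rewrite inE/= in_itv/= andbT => t0.
  rewrite ger0_norm ?dominating_density_ge0//; over.
by rewrite integral_dominating_density// ltry.
Qed.

Lemma integrable_Gamma_integrand {R : realType} (x : R) : 0 < x ->
  lebesgue_measure.-integrable `]0%R, +oo[ (EFin \o Gamma_integrand x).
Proof.
move=> x0; have [K K0 HK] := Gamma_integrand_dominated x0.
have KI : lebesgue_measure.-integrable `]0%R, +oo[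
    (fun t => K%:E * (dominating_density x t)%:E)%E.
  by apply: integrableZl => //; exact: integrable_dominating_density.
apply: le_integrable KI => //=.
  by apply/measurable_EFinP; exact: measurable_Gamma_integrand.
move=> t /=; rewrite in_itv/= andbT => t0.
rewrite lee_fin !ger0_norm ?Gamma_integrand_ge0 ?HK//.
by rewrite mulr_ge0 ?(ltW K0)// dominating_density_ge0.
Qed.

Lemma integral_Gamma_integrand {R : realType} (x : R) : 0 < x ->
  (\int[lebesgue_measure]_(t in `]0%R, +oo[) (Gamma_integrand x t)%:E
   = (Gamma x)%:E)%E.
Proof.
move=> x0; rewrite /Gamma /Rintegral fineK//.
exact: (integrable_fin_num _ (integrable_Gamma_integrand x0)).
Qed.

(** Prepares the integration by parts in [GammaS]: [Gamma_integrand (x + 1)], that is t^x e^(-t), is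
    also the boundary term, and the next two lemmas show that it vanishes at both ends. *)
Lemma is_derive_powR_expRN {R : realType} (x t : R) : 0 < t ->
  is_derive t 1 (Gamma_integrand (x + 1))
    (x * Gamma_integrand x t - Gamma_integrand (x + 1) t).
Proof.
move=> t0.
have D1 := is_derive1_powR x t0.
have D2 := is_derive1_comp (is_derive_expR (- t)) (is_deriveN (is_derive_id t 1)).
have := is_deriveM D1 D2.
rewrite (_ : (powR (R:=R))^~ x * (expR \o -%R) = Gamma_integrand (x + 1));
  last first.
  by apply/funext => u; rewrite /Gamma_integrand addrK.
move=> D; apply: is_derive_eq D _.
by rewrite /Gamma_integrand addrK /GRing.scale /comp/=; ring.
Qed.

Lemma powR_expRN_cvg0 {R : realType} (x : R) : 0 < x ->
  Gamma_integrand (x + 1) t @[t --> 0^'+] --> (0 : R).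
Proof.
move=> x0.
apply: (@squeeze_cvgr _ _ _ _ (cst 0) (fun u : R => u `^ x)).
- near=> t; have t0 : 0 < t by near: t; exact: nbhs_right_gt.
  rewrite Gamma_integrand_ge0 /Gamma_integrand addrK/= ler_piMr ?powR_ge0//.
  by rewrite expR_le1; lra.
- exact: cvg_cst.
- exact: powR_cvg0.
Unshelve. all: by end_near. Qed.

(** The domination at x + 1 already contains the decay: the density there is at most (x + 1) / t,
    because (t / (1 + t))^x <= 1 and (1 + t)^2 >= t. *)
Lemma powR_expRN_cvgy {R : realType} (x : R) : 0 < x ->
  Gamma_integrand (x + 1) t @[t --> +oo] --> (0 : R).
Proof.
move=> x0; have x1 : 0 < x + 1 by lra.
have [K K0 HK] := Gamma_integrand_dominated x1.
apply: (@squeeze_cvgr _ _ _ _ (cst 0) (fun u : R => K * (x + 1) * u^-1)).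
- near=> t; have t0 : 0 < t by near: t; exact: nbhs_pinfty_gt.
  have t1 : 0 < 1 + t by lra.
  rewrite Gamma_integrand_ge0/= (le_trans (HK t t0))//.
  rewrite /dominating_density -!mulrA ler_pM2l// ler_pM2l// addrK.
  have h : 0 <= t / (1 + t) <= 1.
    by rewrite divr_ge0 ?(ltW t0) ?(ltW t1)//= ler_pdivrMr//; lra.
  apply: (@le_trans _ _ ((1 + t) ^- 2)).
    rewrite ler_piMl ?invr_ge0 ?exprn_ge0 ?(ltW t1)//.
    apply: (@le_trans _ _ (1 `^ x)); last by rewrite powR1.
    by case/andP: h => h0 h1; rewrite ge0_ler_powR ?nnegrE ?(ltW x0).
  by rewrite lef_pV2 ?posrE ?exprn_gt0//; nra.
- exact: cvg_cst.
- rewrite -(mulr0 (K * (x + 1))); apply: cvgM; first exact: cvg_cst.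
  exact: cvg_invr_pinfty.
Unshelve. all: by end_near. Qed.

Lemma GammaS {R : realType} (x : R) : 0 < x -> Gamma (x + 1) = x * Gamma x.
Proof.
move=> x0; have x1 : 0 < x + 1 by lra.
have [K K0 HK] := Gamma_integrand_dominated x1.
(* Adding the dominating density makes the derivative of t^x e^-t nonnegative,
   as ge0_FTC2_0y requires. *)
pose f t := K * dominating_density (x + 1) t +
  (x * Gamma_integrand x t - Gamma_integrand (x + 1) t).
have I1 := integrable_Gamma_integrand x0.
have I2 := integrable_Gamma_integrand x1.
have I3 := integrable_dominating_density x1.
have xI1 : lebesgue_measure.-integrable `]0%R, +oo[
    (EFin \o (fun t => x * Gamma_integrand x t)).
  exact: (@integrableZl _ _ _ lebesgue_measure _ _ x (EFin \o Gamma_integrand x)).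
have KI3 : lebesgue_measure.-integrable `]0%R, +oo[
    (EFin \o (fun t => K * dominating_density (x + 1) t)).
  exact: (@integrableZl _ _ _ lebesgue_measure _ _ K (EFin \o
    dominating_density (x + 1))).
have xI12 : lebesgue_measure.-integrable `]0%R, +oo[
    (EFin \o (fun t => x * Gamma_integrand x t - Gamma_integrand (x + 1) t)).
  exact: (@integrableB _ _ _ lebesgue_measure _ _ (EFin \o (fun t => x
    * Gamma_integrand x t)) (EFin \o Gamma_integrand (x + 1))).
(* The primitive of [f] rises from 0 to [K], which is the integral of the dominating part alone;
   hence x t^(x - 1) e^(-t) - t^x e^(-t) integrates to 0. *)
have E1 : \int[lebesgue_measure]_(t in `]0, +oo[) f t = K.
  suff e : (\int[lebesgue_measure]_(t in `]0%R, +oo[) (f t)%:E =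
      (K * 1 + 0)%:E - (K * 0 + 0)%:E)%E.
    by rewrite /Rintegral e /= mulr1 mulr0 !addr0 subr0.
  apply: (@ge0_FTC2_0y _ _ (fun t => K * dominating_primitive (x + 1) t
    + Gamma_integrand (x + 1) t)).
  - move=> t t0; rewrite /f addrA addrAC addr_ge0 ?subr_ge0 ?HK//.
    by rewrite mulr_ge0 ?(ltW x0)// Gamma_integrand_ge0.
  - move=> t t0.
    have cG y : {for t, continuous (Gamma_integrand y)}.
      have [+ _] := is_derive_powR_expRN (y - 1) t0.
      by rewrite subrK => /derivable1_diffP/differentiable_continuous.
    apply: cvgD.
      by apply: cvgM; [exact: cvg_cst|exact: continuous_dominating_density].
    by apply: cvgB; [apply: cvgM; [exact: cvg_cst|exact: cG]|exact: cG].
  - move=> t t0.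
    exact: (is_deriveD (is_deriveZ K (is_derive_dominating (x + 1) t0))
      (is_derive_powR_expRN x t0)).
  - apply: cvgD; last exact: powR_expRN_cvg0.
    by apply: cvgM; [exact: cvg_cst|exact: dominating_primitive_cvg0].
  - apply: cvgD; last exact: powR_expRN_cvgy.
    by apply: cvgM; [exact: cvg_cst|exact: dominating_primitive_cvgy].
move: E1; rewrite /f RintegralD; [|exact: measurable_itv|exact: KI3|exact: xI12].
rewrite RintegralB; [|exact: measurable_itv|exact: xI1|exact: I2].
rewrite RintegralZl; [|exact: measurable_itv|exact: I3].
rewrite RintegralZl; [|exact: measurable_itv|exact: I1].
rewrite [X in K * X]/Rintegral integral_dominating_density//= mulr1.
rewrite -/(Gamma x) -/(Gamma (x + 1)).
by move: (Gamma _) (Gamma _) => G1 G2; lra.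
Qed.

(** On [1, 2] one has 0 <= ln t <= 1, so the integrand exp((x - 1) ln t - t) is at least exp(- |x -
    1| - 2) there, and this interval has length 1. *)
Lemma Gamma_gt0 {R : realType} (x : R) : 0 < x -> 0 < Gamma x.
Proof.
move=> x0; pose c := expR (- `|x - 1| - 2) : R.
apply: (@lt_le_trans _ _ c); first exact: expR_gt0.
rewrite -lee_fin -integral_Gamma_integrand//.
apply: (@le_trans _ _ (\int[lebesgue_measure]_(t in `[1%R, 2%R]) c%:E)%E).
  rewrite integral_cst//= lebesgue_measure_itv/= lte_fin ltr1n/= -EFinB -EFinM.
  by rewrite lee_fin (_ : 2 - 1 = 1 :> R) ?mulr1//; ring.
apply: (@le_trans _ _ (\int[lebesgue_measure]_(t in `[1%R,
  2%R]) (Gamma_integrand x t)%:E)%E).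
  apply: ge0_le_integral => //=.
  - by move=> t _; rewrite lee_fin expR_ge0.
  - by apply/measurable_EFinP; exact: measurable_Gamma_integrand.
  - move=> t; rewrite in_itv/= => /andP[t1 t2]; have t0 : 0 < t by lra.
    rewrite lee_fin /Gamma_integrand /powR gt_eqF// -expRD ler_expR.
    have l0 := ln_ge0 t1; have l1 : ln t <= 1 by have := ln_le_sub1 t0; lra.
    have : `|(x - 1) * ln t| <= `|x - 1|.
      by rewrite normrM ler_piMr// ger0_norm.
    by rewrite ler_norml => /andP[+ _]; lra.
apply: ge0_subset_integral => //=.
- by apply/measurable_EFinP; exact: measurable_Gamma_integrand.
- by move=> t _; rewrite lee_fin Gamma_integrand_ge0.
- by move=> t /=; rewrite !in_itv/= => /andP[t1 t2]; rewrite andbT; lra.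
Qed.

(** * Growth of ratios of Gamma values *)

Lemma powR_le_tangent {R : realType} (k y : R) : 0 <= k <= 1 -> 0 < y ->
  y `^ k <= 1 + k * (y - 1).
Proof.
move=> /andP[k0 k1] y0; set m := 1 + k * (y - 1).
have m0 : 0 < m by rewrite /m; nra.
rewrite -[leRHS]lnK ?posrE// /powR gt_eqF// ler_expR.
have h1 : ln (y / m) <= y / m - 1 by apply: ln_le_sub1; rewrite divr_gt0.
have h2 : ln (1 / m) <= 1 / m - 1 by apply: ln_le_sub1; rewrite divr_gt0.
rewrite ln_div ?posrE// in h1; rewrite ln_div ?posrE// ln1 in h2.
(* [m] is the mean of y and 1 with weights k and 1 - k, so the two logarithm bounds with these
   weights add up to k ln y - ln m <= 0. *)
have e : k * (y / m - 1) + (1 - k) * (1 / m - 1) = 0.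
  by rewrite /m; field; rewrite gt_eqF.
have h1' := ler_wpM2l k0 h1.
have h2' : (1 - k) * (0 - ln m) <= (1 - k) * (1 / m - 1).
  by apply: ler_wpM2l => //; rewrite subr_ge0.
by lra.
Qed.

(* Integrate t^k <= x^k (1 + k (t / x - 1)) against t^(x-1) e^-t dt; the right-hand
   side integrates exactly because Gamma (x + 1) = x Gamma x. *)
Lemma Gamma_le_powR {R : realType} (x k : R) : 0 < x -> 0 <= k <= 1 ->
  Gamma (x + k) <= x `^ k * Gamma x.
Proof.
move=> x0 k01; have /andP[k0 k1] := k01.
have xk0 : 0 < x + k by lra.
have x1 : 0 < x + 1 by lra.
pose a := x `^ k * k / x; pose b := x `^ k * (1 - k).
have I0 := integrable_Gamma_integrand xk0.
have Ix := integrable_Gamma_integrand x0.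
have I1 := integrable_Gamma_integrand x1.
have aI : lebesgue_measure.-integrable `]0%R, +oo[
    (EFin \o (fun t => a * Gamma_integrand (x + 1) t)).
  exact: (@integrableZl _ _ _ lebesgue_measure _ _ a (EFin \o Gamma_integrand
    (x + 1))).
have bI : lebesgue_measure.-integrable `]0%R, +oo[
    (EFin \o (fun t => b * Gamma_integrand x t)).
  exact: (@integrableZl _ _ _ lebesgue_measure _ _ b (EFin \o Gamma_integrand x)).
have abI : lebesgue_measure.-integrable `]0%R, +oo[
    (EFin \o (fun t => a * Gamma_integrand (x + 1) t + b * Gamma_integrand x t)).
  exact: (@integrableD _ _ _ lebesgue_measure _ _ (EFin \o (fun t => a
    * Gamma_integrand (x + 1) t)) (EFin \o (fun t => b * Gamma_integrand x t))).
have -> : x `^ k * Gamma x = a * Gamma (x + 1) + b * Gamma x.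
  by rewrite GammaS// /a /b; field; rewrite gt_eqF.
apply: (@le_trans _ _ (\int[lebesgue_measure]_(t in `]0, +oo[)
   (a * Gamma_integrand (x + 1) t + b * Gamma_integrand x t))).
  apply: le_Rintegral; [exact: measurable_itv|exact: I0|exact: abI|].
  move=> t /=; rewrite in_itv/= andbT => t0.
  have h : t `^ k <= x `^ k * (1 + k * (t / x - 1)).
    have tx : 0 < t / x by rewrite divr_gt0.
    have e : t `^ k = x `^ k * (t / x) `^ k.
      by rewrite -powRM ?(ltW x0) ?(ltW tx)// mulrCA divff ?mulr1// gt_eqF.
    rewrite e; apply: ler_wpM2l; first exact: powR_ge0.
    exact: powR_le_tangent.
  have e1 : Gamma_integrand (x + k) t = t `^ k * Gamma_integrand x t.
    rewrite /Gamma_integrand mulrA -powRD ?(gt_eqF t0) ?implybT//.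
    by congr (_ `^ _ * _); ring.
  have e2 : Gamma_integrand (x + 1) t = t * Gamma_integrand x t.
    by rewrite /Gamma_integrand mulrA addrK mulr_powRB1// ltW.
  suff : Gamma_integrand (x + k) t <=
    a * Gamma_integrand (x + 1) t + b * Gamma_integrand x t by [].
  rewrite e1 e2; apply: le_trans (ler_wpM2r (Gamma_integrand_ge0 x t) h) _.
  by rewrite le_eqVlt; apply/orP; left; apply/eqP; rewrite /a /b; field;
    rewrite gt_eqF.
rewrite RintegralD; [|exact: measurable_itv|exact: aI|exact: bI].
rewrite RintegralZl; [|exact: measurable_itv|exact: I1].
rewrite RintegralZl; [|exact: measurable_itv|exact: Ix].
by [].
Qed.

Lemma addr_div_cvg1 {R : realType} (s : R) : (p + s) / p @[p --> +oo] --> (1 : R).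
Proof.
have : 1 + s * p^-1 @[p --> +oo] --> (1 + s * 0 : R).
  apply: cvgD; first exact: cvg_cst.
  apply: cvgM; first exact: cvg_cst.
  exact: cvg_invr_pinfty.
rewrite mulr0 addr0; apply: cvg_trans; apply: near_eq_cvg; near=> p.
by field; rewrite gt_eqF//; near: p; exact: nbhs_pinfty_gt.
Unshelve. all: by end_near. Qed.

(** Wendel's argument: [Gamma_le_powR] from p to p + s bounds the ratio above by 1, and the same
    inequality from p + s to p + 1, where Gamma (p + 1) = p Gamma p, bounds it below by p / (p +
    s). *)
Lemma Gamma_ratio_cvg1_unit {R : realType} (s : R) : 0 <= s <= 1 ->
  Gamma (p + s) / (Gamma p * p `^ s) @[p --> +oo] --> (1 : R).
Proof.
move=> /andP[s0 s1].
apply: (@squeeze_cvgr _ _ _ _ (fun p => ((p + s) / p)^-1) (cst 1)).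
- near=> p; have p0 : 0 < p by near: p; exact: nbhs_pinfty_gt.
  have G0 := Gamma_gt0 p0; have q0 := powR_gt0 s p0; have ps : 0 < p + s by lra.
  have Gs := Gamma_gt0 ps.
  rewrite ler_pdivrMr ?mulr_gt0// ler_pdivlMr ?mulr_gt0// mul1r.
  rewrite [X in _ && X](_ : _ = true) ?andbT; last first.
    by rewrite [leRHS]mulrC; apply: Gamma_le_powR => //; rewrite s0.
  rewrite invfM invrK -mulrA ler_pdivrMl//.
  have h : Gamma (p + 1) <= (p + s) `^ (1 - s) * Gamma (p + s).
    rewrite (_ : p + 1 = p + s + (1 - s)); last ring.
    apply: Gamma_le_powR => //.
    by rewrite subr_ge0 s1 lerBlDr lerDl.
  rewrite GammaS// in h; rewrite mulrA.
  apply: le_trans (ler_wpM2r (ltW q0) h) _.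
  rewrite mulrAC; apply: ler_wpM2r; first exact: ltW.
  apply: (@le_trans _ _ ((p + s) `^ (1 - s) * (p + s) `^ s)).
    apply: ler_wpM2l; first exact: powR_ge0.
    by apply: ge0_ler_powR; rewrite ?nnegrE ?lerDl ?(ltW p0) ?(ltW ps).
  by rewrite -powRD ?(gt_eqF ps) ?implybT// subrK powRr1// ltW.
- have := cvgV (@oner_neq0 R) (addr_div_cvg1 s).
  by rewrite invr1; exact.
- exact: cvg_cst.
Unshelve. all: by end_near. Qed.

(** Induction on the integer part of s: each use of the functional equation lowers s by 1 at the
    cost of a factor (p + s - 1) / p, which tends to 1. *)
Lemma Gamma_ratio_cvg1 {R : realType} (s : R) : 0 <= s ->
  Gamma (p + s) / (Gamma p * p `^ s) @[p --> +oo] --> (1 : R).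
Proof.
move=> s0; have /andP[] := truncn_itv s0; move: (Num.truncn s) => n.
elim: n s s0 => [|n IH] s s0 n1 n2.
  by apply: Gamma_ratio_cvg1_unit; rewrite s0 ltW.
have s1 : 0 <= s - 1 by rewrite subr_ge0 (le_trans _ n1)// ler1n.
have : ((p + (s - 1)) / p) * (Gamma (p + (s - 1)) / (Gamma p * p `^ (s - 1)))
  @[p --> +oo] --> (1 * 1 : R).
  apply: cvgM; first exact: addr_div_cvg1.
  apply: IH => //; first by rewrite lerBrDr natr1.
  by rewrite ltrBlDr natr1.
rewrite mulr1; apply: cvg_trans; apply: near_eq_cvg; near=> p.
have p0 : 0 < p by near: p; exact: nbhs_pinfty_gt.
have ps : 0 < p + (s - 1) by lra.
rewrite (_ : p + s = p + (s - 1) + 1); last ring.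
rewrite GammaS// -(mulr_powRB1 (ltW p0) (_ : 0 < s)); last lra.
move: (Gamma_gt0 p0) (powR_gt0 (s - 1) p0).
move: (Gamma p) (Gamma _) (p `^ _) => G1 G2 q *.
by field; rewrite !gt_eqF.
Unshelve. all: by end_near. Qed.

(** * Gauss's summation theorem *)

Lemma pochhammer0 {R : realType} (x : R) : pochhammer x 0 = 1.
Proof. by rewrite /pochhammer big_ord0. Qed.

Lemma pochhammerS {R : realType} (x : R) n :
  pochhammer x n.+1 = pochhammer x n * (x + n%:R).
Proof. by rewrite /pochhammer big_ord_recr. Qed.

Lemma pochhammer_gt0 {R : realType} (x : R) n : 0 < x -> 0 < pochhammer x n.
Proof.
move=> x0; elim: n => [|n IH]; first by rewrite pochhammer0.
by rewrite pochhammerS mulr_gt0// ltr_wpDr.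
Qed.

Lemma pochhammerSl {R : realType} (x : R) n :
  x * pochhammer (x + 1) n = pochhammer x n * (x + n%:R).
Proof.
elim: n => [|n IH]; first by rewrite !pochhammer0 addr0 mulr1 mul1r.
by rewrite !pochhammerS mulrA IH -addrA -natr1 [1 + _]addrC.
Qed.

Lemma hyp2F1_coeff0 {R : realType} (u v w z : R) : hyp2F1_coeff u v w z 0 = 1.
Proof.
by rewrite /hyp2F1_coeff !pochhammer0 expr0 fact0 !divr1 !mulr1.
Qed.

Lemma hyp2F1_coeff_gt0 {R : realType} (u v w : R) n :
  0 < u -> 0 < v -> 0 < w -> 0 < hyp2F1_coeff u v w 1 n.
Proof.
move=> u0 v0 w0; rewrite /hyp2F1_coeff expr1n.
by rewrite !(mulr_gt0, invr_gt0, pochhammer_gt0, ltr0n, fact_gt0).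
Qed.

Lemma hyp2F1_coeff1E {R : realType} (u v w z : R) n :
  hyp2F1_coeff u v w z n = hyp2F1_coeff u v w 1 n * z ^+ n.
Proof. by rewrite /hyp2F1_coeff expr1n; ring. Qed.

Lemma hyp2F1_coeffS {R : realType} (u v w : R) n : 0 < w ->
  hyp2F1_coeff u v w 1 n.+1 = hyp2F1_coeff u v w 1 n *
    ((u + n%:R) * (v + n%:R) / ((w + n%:R) * n.+1%:R)).
Proof.
move=> w0; rewrite /hyp2F1_coeff !pochhammerS !expr1n factS natrM.
have h1 := pochhammer_gt0 n w0;
  have h2 : 0 < n`!%:R :> R by rewrite ltr0n fact_gt0.
have h3 : 0 < w + n%:R by rewrite ltr_wpDr.
have h4 : 0 < n.+1%:R :> R by rewrite ltr0n.
by move: h4; set k := n.+1%:R => h4; field; rewrite !gt_eqF.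
Qed.

Lemma hyp2F1_coeff_shift {R : realType} (u v w : R) n : 0 < w ->
  hyp2F1_coeff u v (w + 1) 1 n = hyp2F1_coeff u v w 1 n * (w / (w + n%:R)).
Proof.
move=> w0; rewrite /hyp2F1_coeff.
have h1 := pochhammer_gt0 n w0;
  have h2 : 0 < n`!%:R :> R by rewrite ltr0n fact_gt0.
have h3 : 0 < w + n%:R by rewrite ltr_wpDr.
have -> : pochhammer (w + 1) n = pochhammer w n * (w + n%:R) / w.
  by rewrite -pochhammerSl; field; rewrite gt_eqF.
by field; rewrite !gt_eqF.
Qed.

(* The telescoped form, for partial sums, of
   (w - u) (w - v) 2F1(u, v; w + 1; 1) = w (w - u - v) 2F1(u, v; w; 1). *)
Lemma Gauss_contiguous {R : realType} (u v s : R) N : 0 < u -> 0 < v -> 0 < s ->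
  let w := u + v + s in
  (u + s) * (v + s) * series (hyp2F1_coeff u v (w + 1) 1) N =
  w * s * series (hyp2F1_coeff u v w 1) N + w * N%:R * hyp2F1_coeff u v w 1 N.
Proof.
move=> u0 v0 s0 w; have w0 : 0 < w by rewrite /w; lra.
elim: N => [|N IH].
  by rewrite !seriesEnat/= !big_geq// !mulr0 mul0r addr0.
move: IH; rewrite !seriesEnat/= !big_nat_recr//= => IH.
rewrite mulrDr IH hyp2F1_coeff_shift// hyp2F1_coeffS//.
have h3 : 0 < w + N%:R by rewrite ltr_wpDr.
have h4 : N.+1%:R = N%:R + 1 :> R by rewrite natr1.
have h5 : 0 < N%:R + 1 :> R by rewrite natr1.
rewrite h4 /w in h3 *; field.
by rewrite !gt_eqF.
Qed.

(** The closed form of 2F1(u, v; w; 1), written in the excess s = w - u - v because s is the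
    variable that is shifted to infinity. *)
Definition Gauss_value {R : realType} (u v s : R) : R :=
  Gamma (u + v + s) * Gamma s / (Gamma (u + s) * Gamma (v + s)).

Lemma Gauss_value_gt0 {R : realType} (u v s : R) : 0 < u -> 0 < v -> 0 < s ->
  0 < Gauss_value u v s.
Proof.
by move=> u0 v0 s0; rewrite !(mulr_gt0, invr_gt0, Gamma_gt0)// !addr_gt0.
Qed.

(** This is the recurrence in s that the contiguous relation gives for 2F1(u, v; u + v + s; 1), so
    the quotient of the two is invariant under s -> s + 1. *)
Lemma Gauss_valueS {R : realType} (u v s : R) : 0 < u -> 0 < v -> 0 < s ->
  Gauss_value u v (s + 1) * ((u + s) * (v + s)) =
  Gauss_value u v s * ((u + v + s) * s).
Proof.
move=> u0 v0 s0; rewrite /Gauss_value !addrA !GammaS ?addr_gt0//.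
have us0 : 0 < u + s by lra.
have vs0 : 0 < v + s by lra.
move: (Gamma_gt0 us0) (Gamma_gt0 vs0).
move: (Gamma (u + s)) (Gamma (v + s)) (Gamma s) (Gamma _) => g1 g2 g3 g4 *.
by field; rewrite !gt_eqF.
Qed.

(** Each Gamma value is compared with Gamma p; the powers p^(u + v) and p^u p^v then cancel. *)
Lemma Gauss_value_cvg1 {R : realType} (u v : R) : 0 < u -> 0 < v ->
  Gauss_value u v p @[p --> +oo] --> (1 : R).
Proof.
move=> u0 v0; have uv0 : 0 <= u + v by lra.
have : Gamma (p + (u + v)) / (Gamma p * p `^ (u + v)) *
    (Gamma (p + u) / (Gamma p * p `^ u) * (Gamma (p + v) / (Gamma p * p `^ v)))^-1
    @[p --> +oo] --> (1 * (1 * 1)^-1 : R).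
  apply: cvgM; first exact: Gamma_ratio_cvg1.
  apply: cvgV; first by rewrite mulr1 oner_neq0.
  by apply: cvgM; [exact: (Gamma_ratio_cvg1 (ltW u0))|exact: (Gamma_ratio_cvg1
    (ltW v0))].
rewrite !mulr1 invr1 mulr1 => H; apply: cvg_trans H; apply: near_eq_cvg; near=> p.
have p0 : 0 < p by near: p; exact: nbhs_pinfty_gt.
rewrite /Gauss_value /= powRD ?(gt_eqF p0) ?implybT//.
rewrite [u + v + p]addrC [u + p]addrC [v + p]addrC.
have pu0 : 0 < p + u by lra.
have pv0 : 0 < p + v by lra.
move: (Gamma_gt0 pu0) (Gamma_gt0 pv0) (Gamma_gt0 p0) (powR_gt0 u p0)
  (powR_gt0 v p0).
move: (Gamma (p + u)) (Gamma (p + v)) (Gamma p) (Gamma _) (p `^ u) (p `^ v).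
move=> g1 g2 g3 g4 q1 q2 *; by field; rewrite !gt_eqF.
Unshelve. all: by end_near. Qed.

(* f s <= f (s + m) <= g (s + m) for every natural m. *)
Lemma le_lim_of_shift {R : realType} (f g : R -> R) (l s : R) : 0 < s ->
  (forall p, 0 < p -> f p <= f (p + 1)) -> (forall p, 0 < p -> f p <= g p) ->
  g p @[p --> +oo] --> l -> f s <= l.
Proof.
move=> s0 f1 fg gl; apply/ler_addgt0Pr => e e0.
have /cvgrPdist_le /(_ e e0) [M [Mr HM]] := gl.
have [m Hm] : exists m : nat, M < s + m%:R.
  exists (Num.truncn `|M|).+1; have /andP[_ h] := truncn_itv (normr_ge0 M).
  by apply: (le_lt_trans (ler_norm M)); apply: (lt_trans h); rewrite ltrDr.
have sm0 n : 0 < s + n%:R by rewrite ltr_wpDr.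
have fm n : f s <= f (s + n%:R).
  elim: n => [|n IH]; first by rewrite addr0.
  by rewrite (le_trans IH)// -natr1 addrA f1.
apply: (le_trans (fm m)); apply: (le_trans (fg _ (sm0 m))).
by have := HM _ Hm; rewrite ler_norml => /andP[]; lra.
Qed.

Lemma hyp2F1_coeff1_cvg0 {R : realType} (u v : R) n : 0 < u -> 0 < v ->
  hyp2F1_coeff u v (u + v + p) 1 n.+1 @[p --> +oo] --> (0 : R).
Proof.
move=> u0 v0; pose K : R := pochhammer u n.+1 * pochhammer v n.+1 / n.+1`!%:R.
have K0 : 0 < K by rewrite !(mulr_gt0, invr_gt0, pochhammer_gt0, ltr0n, fact_gt0).
apply: (@squeeze_cvgr _ _ _ _ (cst 0) (fun p => K * p^-1)).
- near=> p; have p1 : 1 < p by near: p; apply: nbhs_pinfty_gt; rewrite num_real.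
  have w0 : 0 < u + v + p by lra.
  rewrite ltW ?hyp2F1_coeff_gt0//=.
  (* The first factor of the product is at least p, and every later one is at least 1 since p >
     1. *)
  have pl : p <= pochhammer (u + v + p) n.+1.
    elim: n {K K0} => [|n IH]; first by rewrite pochhammerS pochhammer0 addr0;
      lra.
    rewrite pochhammerS (le_trans IH)// ler_peMr ?(ltW (pochhammer_gt0 _ w0))//.
    by rewrite -natr1; have : 0 <= n%:R :> R by []; lra.
  rewrite /hyp2F1_coeff expr1n mul1r /K -mulrA [_^-1 / _]mulrC mulrA.
  rewrite ler_wpM2l ?lef_pV2 ?posrE ?pochhammer_gt0//; first exact: ltW.
- exact: cvg_cst.
- rewrite -(mulr0 K); apply: cvgM; first exact: cvg_cst.
  exact: cvg_invr_pinfty.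
Unshelve. all: by end_near. Qed.

Lemma series_hyp2F1_coeff_cvg1 {R : realType} (u v : R) N : 0 < u -> 0 < v ->
  series (hyp2F1_coeff u v (u + v + p) 1) N.+1 @[p --> +oo] --> (1 : R).
Proof.
move=> u0 v0; elim: N => [|N IH].
  under eq_fun do rewrite seriesEnat/= big_nat1 hyp2F1_coeff0.
  exact: cvg_cst.
have : series (hyp2F1_coeff u v (u + v + p) 1) N.+1 +
    hyp2F1_coeff u v (u + v + p) 1 N.+1 @[p --> +oo] --> (1 + 0 : R).
  by apply: cvgD; [exact: IH|exact: hyp2F1_coeff1_cvg0].
by rewrite addr0; under eq_fun do rewrite -seriesSr.
Qed.

(** The quotient [f] of the partial sum by the Gauss value does not decrease under p -> p + 1, as
    the remainder in [Gauss_contiguous] is nonnegative, and it tends to 1. Convergence of the series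
    at 1 is deduced from this bound. The empty sum is treated apart because its quotient does not
    tend to 1. *)
Lemma series_hyp2F1_le_Gauss_value {R : realType} (u v s : R) N :
  0 < u -> 0 < v -> 0 < s ->
  series (hyp2F1_coeff u v (u + v + s) 1) N <= Gauss_value u v s.
Proof.
move=> u0 v0 s0; case: N => [|N].
  by rewrite seriesEnat/= big_geq// ltW// Gauss_value_gt0.
pose f p := series (hyp2F1_coeff u v (u + v + p) 1) N.+1 / Gauss_value u v p.
suff : f s <= 1 by rewrite ler_pdivrMr ?Gauss_value_gt0// mul1r.
apply: (@le_lim_of_shift _ f f _ s s0) => [p p0|p _|]; last first.
- have : series (hyp2F1_coeff u v (u + v + p) 1) N.+1 * (Gauss_value u v p)^-1
      @[p --> +oo] --> (1 * 1^-1 : R).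
    apply: cvgM; first exact: series_hyp2F1_coeff_cvg1.
    by apply: cvgV; [exact: oner_neq0|exact: Gauss_value_cvg1].
  by rewrite invr1 mulr1.
- exact: lexx.
have p1 : 0 < p + 1 by lra.
have w0 : 0 < u + v + p by lra.
have k0 : 0 < (u + v + p) * p by rewrite mulr_gt0.
have D0 : 0 <= (u + v + p) * N.+1%:R * hyp2F1_coeff u v (u + v + p) 1 N.+1.
  apply: mulr_ge0; first by rewrite mulr_ge0// ltW.
  exact: ltW (hyp2F1_coeff_gt0 N.+1 u0 v0 w0).
have := Gauss_contiguous N.+1 u0 v0 p0; rewrite /f [u + v + (p + 1)]addrA.
move: D0 (Gauss_valueS u0 v0 p0) (Gauss_value_gt0 u0 v0 p0)
  (Gauss_value_gt0 u0 v0 p1).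
move: (series (hyp2F1_coeff u v (u + v + p) 1) N.+1)
  (series (hyp2F1_coeff u v (u + v + p + 1) 1) N.+1)
  (Gauss_value u v p) (Gauss_value u v (p + 1)) (_ * _ * hyp2F1_coeff _ _ _ _ _).
move=> S S' G G' D D0 h1 G0 G1 h2.
rewrite ler_pdivrMr// mulrAC ler_pdivlMr//.
rewrite -(ler_pM2r k0) -[leRHS]mulrA -h1 mulrAC.
rewrite [leRHS](_ : _ = (u + p) * (v + p) * S' * G'); last by ring.
by apply: ler_wpM2r; [exact: ltW|rewrite h2 [S * _]mulrC lerDl].
Qed.

Lemma is_cvg_series_hyp2F1 {R : realType} (u v s : R) :
  0 < u -> 0 < v -> 0 < s -> cvgn (series (hyp2F1_coeff u v (u + v + s) 1)).
Proof.
move=> u0 v0 s0; apply: nondecreasing_is_cvgn.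
  apply: nondecreasing_series => n _ _.
  by rewrite ltW// hyp2F1_coeff_gt0// !addr_gt0.
exists (Gauss_value u v s) => _ [N _ <-].
exact: series_hyp2F1_le_Gauss_value.
Qed.

(** As N grows in [Gauss_contiguous], the defect of the limiting identity is the limit [D] of the
    remainder w N A_N, so everything reduces to D = 0. *)
Lemma Gauss_contiguous_lim {R : realType} (u v s : R) : 0 < u -> 0 < v -> 0 < s ->
  (u + s) * (v + s) * hyp2F1 u v (u + v + (s + 1)) 1 =
  (u + v + s) * s * hyp2F1 u v (u + v + s) 1.
Proof.
move=> u0 v0 s0; have s1 : 0 < s + 1 by lra.
have w0 : 0 < u + v + s by lra.
have c := is_cvg_series_hyp2F1 u0 v0 s0.
have c' := is_cvg_series_hyp2F1 u0 v0 s1.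
rewrite /hyp2F1; set L := limn _;
  set L' := limn (series (hyp2F1_coeff u v (u + v + s) 1)).
pose D := (u + s) * (v + s) * L - (u + v + s) * s * L'.
have HD : (u + v + s) * N%:R * hyp2F1_coeff u v (u + v + s)
  1 N @[N --> \oo] --> D.
  have : (u + s) * (v + s) * series (hyp2F1_coeff u v (u + v + (s + 1)) 1) N -
     (u + v + s) * s * series (hyp2F1_coeff u v (u + v + s) 1)
       N @[N --> \oo] --> D.
    by apply: cvgB; apply: cvgM => //; exact: cvg_cst.
  apply: cvg_trans; apply: near_eq_cvg; near=> N.
  by rewrite addrA Gauss_contiguous// addrAC subrr add0r.
have D_ge0 : 0 <= D.
  apply: (cvgr_to_ge HD); apply: nearW => N.
  have a0 := hyp2F1_coeff_gt0 N u0 v0 w0.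
  by rewrite mulr_ge0 ?(ltW a0)// mulr_ge0 ?(ltW w0).
suff D_le0 : D <= 0.
  by apply/eqP; rewrite -subr_eq0 eq_le; apply/andP; split.
(* A positive limit of n * A n would bound A n below by a multiple of 1 / n. *)
rewrite leNgt; apply/negP => D0.
have A_cvg0 := cvg_series_cvg_0 c.
set A := hyp2F1_coeff u v (u + v + s) 1 in c HD A_cvg0.
have A0 n : 0 < A n by exact: hyp2F1_coeff_gt0.
(* Adding w A_n, which tends to 0, turns the factor n into n + 1; the expression is then positive at
   every n, also at n = 0, and its inverse matches [harmonic n]. *)
have H : ((u + v + s) * n%:R * A n + (u + v + s) * A n)^-1 @[n --> \oo] --> (D
  + (u + v + s) * 0)^-1.
  apply: cvgV; first by rewrite mulr0 addr0 gt_eqF.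
  by apply: cvgD; [exact: HD|apply: cvgM; [exact: cvg_cst|exact: A_cvg0]].
have [M [Mr HM]] := cvg_seq_bounded (cvgP _ H).
apply: (@dvg_harmonic R).
pose C := (M + 1) * (u + v + s).
have hA n : harmonic n <= C * A n.
  have M1 : M < M + 1 by rewrite ltrDl.
  have /= := HM (M + 1) M1 n I.
  have n0 : 0 < n.+1%:R :> R by rewrite ltr0n.
  have An := A0 n.
  rewrite (_ : _ + _ = (u + v + s) * n.+1%:R * A n); last by rewrite -natr1; ring.
  have h2 : 0 < (u + v + s) * n.+1%:R * A n.
    by apply: mulr_gt0 => //; exact: mulr_gt0.
  rewrite gtr0_norm ?invr_gt0// => h.
  rewrite -div1r ler_pdivrMr//.
  by move: h; rewrite -div1r ler_pdivrMr// /C; lra.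
apply: (@series_le_cvg _ _ (fun n => C * A n) _ _ hA).
- by move=> n; exact: harmonic_ge0.
- by move=> n; exact: le_trans (harmonic_ge0 n) (hA n).
- rewrite (_ : series _ = fun n => C * series A n).
    by apply: is_cvgM => //; exact: is_cvg_cst.
  by apply/funext => n; rewrite !seriesEnat/= mulr_sumr.
Unshelve. all: by end_near. Qed.

(** One inequality is the limit of the bound on partial sums. For the other, the quotient [f] of the
    Gauss value by the sum is invariant under unit shifts and, as the sum is at least 1, is at most
    the Gauss value, which tends to 1. *)
Theorem Gauss_summation {R : realType} (u v s : R) : 0 < u -> 0 < v -> 0 < s ->
  hyp2F1 u v (u + v + s) 1 = Gauss_value u v s.
Proof.
move=> u0 v0 s0.
have ge1 p : 0 < p -> 1 <= hyp2F1 u v (u + v + p) 1.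
  move=> p0; apply: limr_ge; first exact: is_cvg_series_hyp2F1.
  (* The leading term 1 is present from N = 1 on; the partial sum at N = 0 is empty. *)
  exists 1%N => // -[//|n] _; rewrite /= seriesEnat/= big_nat_recl//.
  rewrite hyp2F1_coeff0 lerDl sumr_ge0// => i _.
  by rewrite ltW// hyp2F1_coeff_gt0// !addr_gt0.
have leG p : 0 < p -> hyp2F1 u v (u + v + p) 1 <= Gauss_value u v p.
  move=> p0; apply: limr_le; first exact: is_cvg_series_hyp2F1.
  by apply: nearW => n; exact: series_hyp2F1_le_Gauss_value.
apply/eqP; rewrite eq_le leG//=.
pose f p := Gauss_value u v p / hyp2F1 u v (u + v + p) 1.
suff : f s <= 1 by rewrite ler_pdivrMr ?mul1r// (lt_le_trans ltr01)// ge1.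
apply: (@le_lim_of_shift _ f (Gauss_value u v) _ s s0);
  last exact: Gauss_value_cvg1.
- move=> p p0; have p1 : 0 < p + 1 by lra.
  have k0 : 0 < (u + v + p) * p by rewrite !mulr_gt0// !addr_gt0.
  have F0 : 0 < hyp2F1 u v (u + v + p) 1 by exact: lt_le_trans ltr01 (ge1 p p0).
  have F1 : 0 < hyp2F1 u v (u + v + (p + 1)) 1.
    exact: lt_le_trans ltr01 (ge1 (p + 1) p1).
  rewrite /f; move: F0 F1 (Gauss_contiguous_lim u0 v0 p0) (Gauss_valueS u0 v0 p0).
  move: (hyp2F1 u v (u + v + p) 1) (hyp2F1 u v (u + v + (p + 1)) 1)
    (Gauss_value u v p) (Gauss_value u v (p + 1)).
  move=> A A' G G' A0 A'0 h1 h2.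
  rewrite ler_pdivrMr// mulrAC ler_pdivlMr// -(ler_pM2l k0).
  rewrite [leLHS](_ : _ = G * ((u + v + p) * p) * A'); last by ring.
  rewrite -h2 [leRHS](_ : _ = G' * ((u + v + p) * p * A)); last by ring.
  by rewrite -h1 le_eqVlt; apply/orP; left; apply/eqP; ring.
- move=> p p0; have G0 := Gauss_value_gt0 u0 v0 p0.
  have F1 := ge1 p p0; have F0 := lt_le_trans ltr01 F1.
  rewrite /f; move: G0 F1 F0.
  move: (Gauss_value _ _ _) (hyp2F1 _ _ _ _) => G A G0 A1 A0.
  by rewrite ler_pdivrMr// ler_peMr// ltW.
Qed.

(** * Uniform convergence to the Gaussian *)

(** Multiplying by n^k costs a shift of the parameter by k. In the induction, (M + 2)^k <= (M + 1)^k
    (1 + k / (M + 1)) by the tangent bound, and (x + M) (1 + k / (M + 1)) <= x + k + M because x <=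
    1. The first factor x is kept outside, as it will tend to 0. *)
Lemma pochhammer_mul_powR {R : realType} (x k : R) n :
  0 < x <= 1 -> 0 < k <= 1 ->
  pochhammer x n * n%:R `^ k <= 2 * x / k * pochhammer (x + k) n.
Proof.
move=> /andP[x0 x1] /andP[k0 k1]; have xk0 : 0 < x + k by lra.
have c0 : 0 < 2 * x / k by rewrite divr_gt0// mulr_gt0.
(* The shift to m + 2 in the power makes the induction close. *)
have step m : pochhammer x m.+1 * m.+2%:R `^ k <= 2 * x / k * pochhammer (x
  + k) m.+1.
  elim: m => [|m IH].
    rewrite !pochhammerS !pochhammer0 !mul1r !addr0.
    have h2 : (2 : R) `^ k <= 2 by apply: ler1_powR => //; lra.
    apply: (@le_trans _ _ (x * 2)); first by rewrite ler_pM2l.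
    rewrite [leRHS](_ : _ = x * 2 * ((x + k) / k)); last by field; rewrite gt_eqF.
    by rewrite ler_peMr ?mulr_ge0 ?(ltW x0)// ler_pdivlMr//; lra.
  rewrite pochhammerS [pochhammer (x + k) m.+2]pochhammerS.
  have m0 : 0 < m.+1%:R :> R by rewrite ltr0n.
  have e2 : m.+2%:R = m.+1%:R + 1 :> R by rewrite natr1.
  have e3 : m.+3%:R = m.+1%:R + 2 :> R by rewrite -!natr1; ring.
  rewrite e2 in IH; rewrite e3; set M := m.+1%:R in m0 IH e2 e3 *.
  have M1 : 0 < M + 1 by lra.
  have h : (M + 2) `^ k <= (M + 1) `^ k * (1 + k / (M + 1)).
    have q0 : 0 < (M + 2) / (M + 1) by rewrite divr_gt0//; lra.
    have -> : (M + 2) `^ k = (M + 1) `^ k * ((M + 2) / (M + 1)) `^ k.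
      by rewrite -powRM ?(ltW M1) ?(ltW q0)//; congr (_ `^ _); field;
        rewrite gt_eqF.
    apply: ler_wpM2l; first exact: powR_ge0.
    apply: le_trans (powR_le_tangent _ q0) _; first by rewrite (ltW k0).
    by rewrite le_eqVlt; apply/orP; left; apply/eqP; field; rewrite gt_eqF.
  have p0 := pochhammer_gt0 m.+1 x0; have pk0 := pochhammer_gt0 m.+1 xk0.
  have xM : 0 < x + M by lra.
  apply: (@le_trans _ _ (pochhammer x m.+1 * (x + M) * ((M + 1) `^ k * (1
    + k / (M + 1))))).
    by apply: ler_wpM2l => //; rewrite mulr_ge0// ltW.
  rewrite [leLHS](_ : _ = (pochhammer x m.+1 * (M + 1) `^ k) * ((x + M) * (1
    + k / (M + 1)))); last by ring.
  rewrite [leRHS]mulrA; apply: ler_pM => //.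
  - by rewrite mulr_ge0 ?powR_ge0 ?(ltW p0).
  - by rewrite mulr_ge0 ?(ltW xM)// addr_ge0// divr_ge0 ?(ltW k0) ?(ltW M1).
  - have : k / (M + 1) * (x + M) <= k.
      by rewrite mulrAC ler_pdivrMr//; nra.
    by lra.
case: n => [|m].
  rewrite powR0 ?gt_eqF// mulr0 mulr_ge0 ?(ltW c0)//.
  exact: ltW (pochhammer_gt0 _ _).
apply: le_trans (step m); apply: ler_wpM2l; first exact: ltW (pochhammer_gt0 _ _).
by apply: ge0_ler_powR; rewrite ?nnegrE ?(ltW k0)// ler_nat.
Qed.

(** With a = n (1 - z), the left side is at most 1 and, by Bernoulli's inequality, at most a; and
    min(1, a) <= a^k for 0 < k <= 1. *)
Lemma one_sub_expr_le {R : realType} (z k : R) n :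
  0 <= z <= 1 -> 0 < k <= 1 -> 1 - z ^+ n <= n%:R `^ k * (1 - z) `^ k.
Proof.
move=> /andP[z0 z1] /andP[k0 k1].
have y0 : 0 <= 1 - z by lra.
rewrite -powRM//; set a := n%:R * (1 - z).
have bern : 1 - z ^+ n <= a.
  rewrite /a; elim: n {a} => [|n IH]; first by rewrite expr0 mul0r subrr.
  have zn : 0 <= z ^+ n <= 1 by rewrite exprn_ge0//= exprn_ile1.
  by rewrite exprS -natr1; nra.
have a0 : 0 <= a by rewrite mulr_ge0.
case: (lerP 1 a) => [a1|a1].
  apply: (@le_trans _ _ 1); first by rewrite lerBlDr lerDl exprn_ge0.
  rewrite -[leLHS](_ : 1 `^ k = 1); last by rewrite powR1.
  by apply: ge0_ler_powR; rewrite ?nnegrE// ltW.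
apply: (le_trans bern); move: a0; rewrite le_eqVlt => /predU1P[<-|a0].
  exact: powR_ge0.
by apply: ger1_powR => //; rewrite a0 ltW.
Qed.

Lemma is_cvg_series_hyp2F1_le1 {R : realType} (u v s z : R) :
  0 < u -> 0 < v -> 0 < s -> 0 <= z <= 1 ->
  cvgn (series (hyp2F1_coeff u v (u + v + s) z)).
Proof.
move=> u0 v0 s0 /andP[z0 z1].
have c0 n : 0 <= hyp2F1_coeff u v (u + v + s) 1 n.
  by rewrite ltW// hyp2F1_coeff_gt0// !addr_gt0.
apply: series_le_cvg (is_cvg_series_hyp2F1 u0 v0 s0) => // n.
- by rewrite hyp2F1_coeff1E mulr_ge0// exprn_ge0.
- by rewrite hyp2F1_coeff1E ler_piMr// exprn_ile1.
Qed.

Lemma hyp2F1_ge0 {R : realType} (u v s z : R) :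
  0 < u -> 0 < v -> 0 < s -> 0 <= z <= 1 -> 0 <= hyp2F1 u v (u + v + s) z.
Proof.
move=> u0 v0 s0 z01; apply: limr_ge; first exact: is_cvg_series_hyp2F1_le1.
apply: nearW => N; rewrite seriesEnat/= sumr_ge0// => i _.
case/andP: z01 => z0 _; rewrite hyp2F1_coeff1E mulr_ge0 ?exprn_ge0//.
by rewrite ltW// hyp2F1_coeff_gt0// !addr_gt0.
Qed.

Lemma hyp2F1_le_at1 {R : realType} (u v s z : R) :
  0 < u -> 0 < v -> 0 < s -> 0 <= z <= 1 ->
  hyp2F1 u v (u + v + s) z <= hyp2F1 u v (u + v + s) 1.
Proof.
move=> u0 v0 s0 z01; apply: ler_lim.
- exact: is_cvg_series_hyp2F1_le1.
- exact: is_cvg_series_hyp2F1.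
apply: nearW => N; rewrite !seriesEnat/= ler_sum// => i _.
case/andP: z01 => z0 z1; rewrite hyp2F1_coeff1E ler_piMr ?exprn_ile1//.
by rewrite ltW// hyp2F1_coeff_gt0// !addr_gt0.
Qed.

(** The two preceding estimates are applied term by term. Raising u to u + k with the lower
    parameter fixed reduces the excess to s - k, still positive, so the bound on partial sums by the
    Gauss value applies again. *)
Lemma hyp2F1_at1_sub_le {R : realType} (u v s k z : R) :
  0 < u <= 1 -> 0 < v -> 0 < k <= 1 -> k < s -> 0 <= z <= 1 ->
  hyp2F1 u v (u + v + s) 1 - hyp2F1 u v (u + v + s) z <=
  2 * u / k * (1 - z) `^ k * Gauss_value (u + k) v (s - k).
Proof.
move=> u01 v0 k01 ks z01.
have /andP[u0 u1] := u01; have /andP[k0 k1] := k01.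
have s0 : 0 < s by lra.
have uk0 : 0 < u + k by lra.
have sk0 : 0 < s - k by lra.
have w0 : 0 < u + v + s by lra.
have ew : u + k + v + (s - k) = u + v + s by ring.
have y0 : 0 <= (1 - z) `^ k by exact: powR_ge0.
have C0 : 0 <= 2 * u / k * (1 - z) `^ k
  by rewrite mulr_ge0// divr_ge0 ?(ltW k0)// mulr_ge0// ltW.
have cB : series (hyp2F1_coeff u v (u + v + s) 1) N -
    series (hyp2F1_coeff u v (u + v + s) z) N @[N --> \oo] -->
    hyp2F1 u v (u + v + s) 1 - hyp2F1 u v (u + v + s) z.
  by apply: cvgB; [exact: is_cvg_series_hyp2F1|exact: is_cvg_series_hyp2F1_le1].
apply: (cvgr_to_le cB).
apply: nearW => N.
apply: le_trans (ler_wpM2l C0 (series_hyp2F1_le_Gauss_value N uk0 v0 sk0)).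
rewrite ew !seriesEnat/= -sumrB mulr_sumr ler_sum// => n _.
rewrite (hyp2F1_coeff1E _ _ _ z) -[X in X - _ * z ^+ n]mulr1 -mulrBr.
have c0 := hyp2F1_coeff_gt0 n u0 v0 w0.
apply: le_trans (ler_wpM2l (ltW c0) (one_sub_expr_le n z01 k01)) _.
rewrite /hyp2F1_coeff expr1n.
set pw := pochhammer (u + v + s) n; set pv := pochhammer v n.
have pw0 : 0 < pw by exact: pochhammer_gt0.
have pv0 : 0 < pv by exact: pochhammer_gt0.
have f0 : 0 < n`!%:R :> R by rewrite ltr0n fact_gt0.
set P := pochhammer u n; set P' := pochhammer (u + k) n.
have D0 : 0 <= pv / pw * (1 / n`!%:R) * (1 - z) `^ k.
  by rewrite mulr_ge0// mulr_ge0 ?divr_ge0 ?(ltW pv0) ?(ltW pw0) ?(ltW f0).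
have := ler_wpM2l D0 (pochhammer_mul_powR n u01 k01); rewrite -/P -/P' => h.
rewrite [leLHS](_ : _ = pv / pw * (1 / n`!%:R) * (1 - z) `^ k * (P
  * n%:R `^ k)); last by ring.
by apply: le_trans h _; rewrite le_eqVlt; apply/orP; left; apply/eqP; ring.
Qed.

(** Gamma (u + v + s) and Gamma (u + s) cancel, which removes u; the remaining quotient Gamma (v +
    s) / Gamma (v + s - k) falls under [Gamma_le_powR]. *)
Lemma Gauss_value_ratio_le {R : realType} (u v s k : R) :
  0 < u -> 0 < v -> 0 < k <= 1 -> k < s ->
  Gauss_value (u + k) v (s - k) / Gauss_value u v s <=
  Gamma (s - k) / Gamma s * (v + s - k) `^ k.
Proof.
move=> u0 v0 /andP[k0 k1] ks.
have s0 : 0 < s by lra.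
have sk0 : 0 < s - k by lra.
have vsk0 : 0 < v + s - k by lra.
have us0 : 0 < u + s by lra.
have vs0 : 0 < v + s by lra.
have uvs0 : 0 < u + v + s by lra.
have k01 : 0 <= k <= 1 by rewrite k1 ltW.
have h := Gamma_le_powR vsk0 k01; rewrite subrK in h.
rewrite /Gauss_value.
rewrite (_ : u + k + v + (s - k) = u + v + s); last ring.
rewrite (_ : u + k + (s - k) = u + s); last ring.
rewrite (_ : v + (s - k) = v + s - k); last ring.
move: h (Gamma_gt0 s0) (Gamma_gt0 sk0) (Gamma_gt0 vsk0) (Gamma_gt0 us0)
  (Gamma_gt0 vs0) (Gamma_gt0 uvs0).
move: (Gamma s) (Gamma (s - k)) (Gamma (v + s - k)) (Gamma (u + s))
  (Gamma (v + s)) (Gamma (u + v + s)) => g1 g2 g3 g4 g5 g6 h *.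
rewrite [leLHS](_ : _ = g2 / g1 * (g5 / g3)); last by field; rewrite !gt_eqF.
by apply: ler_wpM2l; rewrite ?divr_ge0 ?ler_pdivrMr// ltW.
Qed.

(** Dividing by [Gauss_value], which is 2F1(1), makes the error relative; its Gamma constant depends
    on s and k alone, which stay fixed in the limit. *)
Lemma hyp2F1_normalized_bounds {R : realType} (u v s k z : R) :
  0 < u <= 1 -> 0 < v -> 0 < k <= 1 -> k < s -> 0 <= z <= 1 ->
  1 - 2 / k * (Gamma (s - k) / Gamma s) * u * ((1 - z) * (v + s)) `^ k
    <= hyp2F1 u v (u + v + s) z / Gauss_value u v s <= 1.
Proof.
move=> u01 v0 k01 ks z01.
have /andP[u0 u1] := u01; have /andP[k0 k1] := k01; have /andP[z0 z1] := z01.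
have s0 : 0 < s by lra.
have sk0 : 0 < s - k by lra.
have y0 : 0 <= 1 - z by lra.
have vs0 : 0 <= v + s by lra.
have C0 : 0 <= 2 * u / k * (1 - z) `^ k.
  by rewrite mulr_ge0 ?powR_ge0// divr_ge0 ?(ltW k0)// mulr_ge0// ltW.
have h3 : (v + s - k) `^ k <= (v + s) `^ k.
  by apply: ge0_ler_powR; rewrite ?nnegrE; lra.
have E1 := Gauss_summation u0 v0 s0.
have h1 := hyp2F1_at1_sub_le u01 v0 k01 ks z01; rewrite E1 in h1.
have h2 := ler_wpM2l C0 (Gauss_value_ratio_le u0 v0 k01 ks).
have h4 := hyp2F1_le_at1 u0 v0 s0 z01; rewrite E1 in h4.
rewrite powRM//.
move: h1 h2 h4 (Gauss_value_gt0 u0 v0 s0) (Gamma_gt0 s0) (Gamma_gt0 sk0).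
move: (hyp2F1 u v _ z) (Gauss_value u v s) (Gauss_value (u + k) v _) (Gamma s)
  (Gamma (s - k)) => f G G' g1 g2 h1 h2 h4 G0 g10 g20.
apply/andP; split; last by rewrite ler_pdivrMr// mul1r.
have gg : 0 <= g2 / g1 by rewrite divr_ge0// ltW.
rewrite lerBlDl -lerBlDr.
apply: (@le_trans _ _ (2 * u / k * (1 - z) `^ k * (G' / G))).
  rewrite mulrA ler_pdivlMr//; apply: le_trans h1.
  by rewrite mulrBl mul1r divfK// gt_eqF.
apply: (le_trans h2); apply: (le_trans (ler_wpM2l C0 (ler_wpM2l gg h3))).
by rewrite le_eqVlt; apply/orP; left; apply/eqP; ring.
Qed.

(** Here v + s = gamma - d / 2 is enlarged to [gamma]. The factor [Q] is hidden behind an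
    existential since the limit uses only its bounds, which also hold outside the ball, where z =
    0. *)
Lemma gauss_hyp_cov_bounds {R : realType} (d : nat) (a alpha beta gamma k : R)
    (h : 'rV[R]_d) :
  0 < beta - alpha <= 1 -> alpha < gamma -> 0 < k <= 1 ->
  k < alpha - d%:R / 2 ->
  let z := pos_part (1 - euclid_norm h ^+ 2 / a ^+ 2) in
  let p := beta - alpha + gamma - d%:R / 2 - 1 in
  let K := 2 / k * (Gamma (alpha - d%:R / 2 - k) / Gamma (alpha - d%:R / 2)) in
  exists Q, [/\ gauss_hyp_cov d a alpha beta gamma h = z `^ p * Q,
    0 <= Q, 1 - K * (beta - alpha) * ((1 - z) * gamma) `^ k <= Q & Q <= 1].
Proof.
move=> u01 v0 k01 ks z p K.
have /andP[u0 u1] := u01; have /andP[k0 k1] := k01.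
have d0 : 0 <= d%:R / 2 :> R by rewrite divr_ge0.
have g0 : 0 < gamma - alpha by lra.
have s0 : 0 < alpha - d%:R / 2 by lra.
have sk0 : 0 < alpha - d%:R / 2 - k by lra.
have x0 : 0 <= euclid_norm h ^+ 2 / a ^+ 2 by rewrite divr_ge0// sqr_ge0.
have z01 : 0 <= z <= 1.
  by rewrite /z /pos_part le_max lexx orbT/= ge_max ler01 andbT gerBl.
have /andP[z0 z1] := z01.
have y0 : 0 <= 1 - z by rewrite subr_ge0.
have ga0 : 0 <= gamma by lra.
have gd0 : 0 <= gamma - alpha + (alpha - d%:R / 2) by lra.
have gd1 : gamma - alpha + (alpha - d%:R / 2) <= gamma by lra.
have b1 : 0 < beta - d%:R / 2 by lra.
have b2 : 0 < gamma - d%:R / 2 by lra.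
have b3 : 0 < beta - alpha + gamma - d%:R / 2 by lra.
have ew : beta - alpha + (gamma - alpha) + (alpha - d%:R / 2) = beta - alpha
  + gamma - d%:R / 2 by ring.
have eb : beta - alpha + (alpha - d%:R / 2) = beta - d%:R / 2 by ring.
have eg : gamma - alpha + (alpha - d%:R / 2) = gamma - d%:R / 2 by ring.
have GV0 := Gauss_value_gt0 u0 g0 s0.
have F0 := hyp2F1_ge0 u0 g0 s0 z01.
have /andP[B1 B2] := hyp2F1_normalized_bounds u01 g0 k01 ks z01.
have K0 : 0 <= K.
  apply: mulr_ge0; first by rewrite divr_ge0// ltW.
  by apply: divr_ge0; apply: ltW; exact: Gamma_gt0.
exists (hyp2F1 (beta - alpha) (gamma - alpha) (beta - alpha + gamma - d%:R / 2)
  z /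
  Gauss_value (beta - alpha) (gamma - alpha) (alpha - d%:R / 2)).
rewrite -ew; split=> //.
- rewrite /gauss_hyp_cov -/z -/p /Gauss_value ew eb eg.
  move: (Gamma_gt0 b1) (Gamma_gt0 b2) (Gamma_gt0 b3) (Gamma_gt0 s0).
  clear -z p; move: (Gamma _) (Gamma _) (Gamma _) (Gamma _).
  move: (hyp2F1 _ _ _ _) (z `^ p) => f zp g1 g2 g3 g4 *.
  by field; rewrite !gt_eqF.
- by rewrite divr_ge0 ?(ltW GV0).
- apply: le_trans B1; rewrite lerD2l lerN2 -/K; apply: ler_wpM2l.
    by apply: mulr_ge0 => //; exact: ltW.
  apply: ge0_ler_powR; rewrite ?nnegrE ?(ltW k0)//.
  - exact: mulr_ge0.
  - exact: mulr_ge0.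
  - exact: ler_wpM2l.
Qed.

(** * Comparison with exponentials and passage to the limit *)

Lemma powR_expR_bounds {R : realType} (y p : R) : 0 <= y < 1 -> 0 <= p ->
  expR (- (p * y / (1 - y))) <= (1 - y) `^ p <= expR (- (p * y)).
Proof.
move=> /andP[y0 y1] p0; have z0 : 0 < 1 - y by lra.
(* The bound ln w <= w - 1 is used at w = 1 - y for the upper estimate and at w = 1 / (1 - y) for
   the lower one. *)
have h1 := ln_le_sub1 z0.
have iz0 : 0 < (1 - y)^-1 by rewrite invr_gt0.
have := ln_le_sub1 iz0; rewrite lnV ?posrE// => h2.
have e : (1 - y)^-1 - 1 = y / (1 - y) by field; rewrite gt_eqF.
rewrite e in h2; rewrite /powR gt_eqF// !ler_expR -mulrA -!mulrN.
by apply/andP; split; apply: ler_wpM2l => //; lra.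
Qed.

(** Factoring out e^(-a) <= 1 leaves 1 - e^(a - b) <= b - a. *)
Lemma expRN_lipschitz {R : realType} (a b : R) : 0 <= a ->
  expR (- a) - expR (- b) <= `|a - b|.
Proof.
move=> a0; have -> : expR (- b) = expR (- a) * expR (a - b).
  by rewrite -expRD; congr expR; ring.
have h1 := expR_ge1Dx (a - b); have h2 := expR_gt0 (- a).
have h3 : expR (- a) <= 1 by rewrite expR_le1; lra.
have h4 := ler_norm (b - a); rewrite distrC in h4.
have h5 := normr_ge0 (a - b).
by nra.
Qed.

Lemma gauss_hyp_cov_cvg {R : realType} (d : nat) (alpha b : R)
    (T : Type) (F : set_system T) {FF : Filter F} (a beta gamma : T -> R) :
  d%:R / 2 < alpha -> 0 < b ->
  (\forall t \near F, hyp_params d alpha (beta t) (gamma t)) ->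
  a t @[t --> F] --> +oo -> beta t @[t --> F] --> alpha ->
  gamma t @[t --> F] --> +oo -> a t / Num.sqrt (gamma t) @[t --> F] --> b ->
  {uniform, gauss_hyp_cov d (a t) alpha (beta t) (gamma t) @[t --> F]
     --> gaussian_cov d b}.
Proof.
move=> alpha_gt b0 params ay betac gammay agc.
move=> P /uniform_nbhs[E [entE subP]].
move: entE; rewrite -entourage_ballE => -[e /= e0 He].
set nu := alpha - d%:R / 2; have nu0 : 0 < nu by rewrite /nu; lra.
(* k <= 1 is required by the power inequalities, and k < nu keeps the excess nu - k positive. *)
pose k : R := Num.min 1 (nu / 2).
have k0 : 0 < k by rewrite /k lt_min ltr01 divr_gt0.
have k1 : k <= 1 by rewrite /k ge_min lexx.
have knu : k < nu by rewrite /k gt_min; apply/orP; right; lra.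
pose K := 2 / k * (Gamma (nu - k) / Gamma nu).
have K0 : 0 <= K.
  rewrite /K mulr_ge0 ?divr_ge0 ?(ltW k0) ?(ltW (Gamma_gt0 nu0))//.
  by apply: ltW; apply: Gamma_gt0; lra.
have k01 : 0 < k <= 1 by rewrite k0 k1.
have bounds t h (u01 : 0 < beta t - alpha <= 1) (v0 : alpha < gamma t) :=
  gauss_hyp_cov_bounds (a t) h u01 v0 k01 knu.
rewrite -/nu -/K in bounds; move: K K0 bounds => K K0 bounds.
have b2 : 0 < b ^+ 2 by rewrite exprn_gt0.
(* For |h|^2 >= X both functions are at most e / 2, since the exponent of the
   covariance is eventually at least |h|^2 / (2 b^2). *)
pose X := 2 * b ^+ 2 * (2 / e).
have X0 : 0 < X by rewrite /X !mulr_gt0 ?invr_gt0.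
(* [e] is the tolerance, not Euler's number; the bound is exp y >= y at y = 2 / e. *)
have eX : expR (- (2 / e)) <= e / 2.
  rewrite expRN -[leRHS]invrK; have := expR_ge1Dx (2 / e) => h.
  have q0 : 0 < 2 / e by rewrite divr_gt0.
  rewrite lef_pV2 ?posrE ?expR_gt0 ?invr_gt0 ?divr_gt0// invf_div; lra.
pose p t := beta t - alpha + gamma t - d%:R / 2 - 1.
(* With x = |h|^2, the upper bound for z^p is exp(- q x), and q tends to 1 / b^2. *)
pose q t := p t / a t ^+ 2.
have near_g : \forall t \near F, 0 < gamma t.
  by apply: (gammay [set x | 0 < x]); exact: nbhs_pinfty_gt.
have near_a : \forall t \near F, 0 < a t.
  by apply: (ay [set x | 0 < x]); exact: nbhs_pinfty_gt.
have ia : (a t)^-1 @[t --> F] --> (0 : R) by apply/(gtr0_cvgV0 near_a).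
have ig : (gamma t)^-1 @[t --> F] --> (0 : R) by apply/(gtr0_cvgV0 near_g).
have ga : gamma t / a t ^+ 2 @[t --> F] --> b ^- 2.
  have : (a t / Num.sqrt (gamma t)
    * (a t / Num.sqrt (gamma t)))^-1 @[t --> F] --> (b * b)^-1.
    by apply: cvgV; [rewrite mulf_neq0 ?gt_eqF|exact: cvgM].
  rewrite -expr2; apply: cvg_trans; apply: near_eq_cvg; near=> t.
  have g0 : 0 < gamma t by near: t.
  have a0 : 0 < a t by near: t.
  rewrite -[X in X / a t ^+ 2](sqr_sqrtr (ltW g0)).
  have sg : 0 < Num.sqrt (gamma t) by rewrite sqrtr_gt0.
  by field; rewrite !gt_eqF.
have pg : p t / gamma t @[t --> F] --> (1 : R).
  have : 1 + (beta t - alpha - d%:R / 2 - 1) * (gamma t)^-1 @[t --> F] --> 1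
    + (alpha - alpha - d%:R / 2 - 1) * 0.
    apply: cvgD; first exact: cvg_cst.
    apply: cvgM => //.
    by apply: cvgB; [apply: cvgB; [apply: cvgB;
      [exact: betac|exact: cvg_cst]|exact: cvg_cst]|exact: cvg_cst].
  rewrite mulr0 addr0; apply: cvg_trans; apply: near_eq_cvg; near=> t.
  have g0 : 0 < gamma t by near: t.
  by rewrite /p; field; rewrite gt_eqF.
have qc : q t @[t --> F] --> b ^- 2.
  have : p t / gamma t * (gamma t / a t ^+ 2) @[t --> F] --> 1 * b ^- 2
    by exact: cvgM.
  rewrite mul1r; apply: cvg_trans; apply: near_eq_cvg; near=> t.
  have g0 : 0 < gamma t by near: t.
  have a0 : 0 < a t by near: t.
  by rewrite /q; field; rewrite !gt_eqF.
have Xac : X / a t ^+ 2 @[t --> F] --> (0 : R).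
  have : X * ((a t)^-1 * (a t)^-1) @[t --> F] --> X * (0 * 0).
    by apply: cvgM; [exact: cvg_cst|exact: cvgM].
  rewrite !mulr0; apply: cvg_trans; apply: near_eq_cvg; near=> t.
  by rewrite expr2 invfM.
(* The lower bound for z^p decays at the rate q / (1 - x / a^2), which increases with x; its value
   at x = X is one rate valid for all x < X. *)
pose r t := q t / (1 - X / a t ^+ 2).
have rc : r t @[t --> F] --> b ^- 2.
  have : q t * (1 - X / a t ^+ 2)^-1 @[t --> F] --> b ^- 2 * (1 - 0)^-1.
    apply: cvgM => //; apply: cvgV; first by rewrite subr0 oner_neq0.
    by apply: cvgB => //; exact: cvg_cst.
  by rewrite subr0 invr1 mulr1.
(* For x < X, (1 - z) gamma = x gamma / a^2 is eventually at most X (b^-2 + 1), so [B] bounds its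
   k-th power. *)
pose B : R := (X * (b ^- 2 + 1)) `^ k.
have errc : K * (beta t - alpha) * B @[t --> F] --> (0 : R).
  have : K * (beta t - alpha) * B @[t --> F] --> K * (alpha - alpha) * B.
    apply: cvgM; last exact: cvg_cst.
    by apply: cvgM; [exact: cvg_cst|apply: cvgB => //; exact: cvg_cst].
  by rewrite subrr mulr0 mul0r.
have n1 : \forall t \near F, alpha < gamma t
  by apply: (gammay [set x | alpha < x]); apply: nbhs_pinfty_gt; rewrite num_real.
have n2 : \forall t \near F, beta t < alpha + 1
  by apply: (cvgr_lt alpha betac); rewrite ltrDl.
have n3 : \forall t \near F, X / a t ^+ 2 < 1 by apply: (cvgr_lt 0 Xac).
have n4 : \forall t \near F, (2 * b ^+ 2)^-1 < q t.
  by apply: (cvgr_gt _ qc); rewrite ltf_pV2 ?posrE ?mulr_gt0//; lra.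
(* Error budget for x < X: e / 4 for the factor [Q] and e / 4 for each change of rate. A rate error
   is multiplied by x in the exponent, hence the division by X. *)
have n5 : \forall t \near F, `|q t - b ^- 2| < e / 4 / X.
  by have /cvgrPdistC_lt := qc; apply; rewrite !divr_gt0.
have n6 : \forall t \near F, `|r t - b ^- 2| < e / 4 / X.
  by have /cvgrPdistC_lt := rc; apply; rewrite !divr_gt0.
have n7 : \forall t \near F, K * (beta t - alpha) * B < e / 4.
  by apply: (cvgr_lt 0 errc); rewrite divr_gt0.
have n8 : \forall t \near F, gamma t / a t ^+ 2 < b ^- 2 + 1.
  by apply: (cvgr_lt _ ga); rewrite ltrDl.
near=> t; apply: subP => h _; apply: He => /=.
have prm : hyp_params d alpha (beta t) (gamma t) by near: t.
have h1 : alpha < gamma t by near: t.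
have h2 : beta t < alpha + 1 by near: t.
have h3 : X / a t ^+ 2 < 1 by near: t.
have h4 : (2 * b ^+ 2)^-1 < q t by near: t.
have h5 : `|q t - b ^- 2| < e / 4 / X by near: t.
have h6 : `|r t - b ^- 2| < e / 4 / X by near: t.
have h7 : K * (beta t - alpha) * B < e / 4 by near: t.
have h8 : gamma t / a t ^+ 2 < b ^- 2 + 1 by near: t.
have a0 : 0 < a t by near: t.
case: prm => [[al0 be0 ga0] _ prm _].
(* The product condition of [hyp_params] forces beta > alpha, since gamma > alpha near the limit. *)
have u0 : 0 < beta t - alpha.
  have := lt_le_trans al0 prm.
  by rewrite pmulr_lgt0 ?subr_gt0// pmulr_rgt0// subr_gt0.
have u01 : 0 < beta t - alpha <= 1 by rewrite u0/=; lra.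
have [Q [-> Q0 Q1 Q2]] := bounds t h u01 h1.
rewrite -/(p t).
rewrite /gaussian_cov; set x := euclid_norm h ^+ 2 in Q1 *.
have x0 : 0 <= x by rewrite sqr_ge0.
have a2 : 0 < a t ^+ 2 by rewrite exprn_gt0.
have q0 : 0 < q t by apply: lt_trans h4; rewrite invr_gt0 mulr_gt0.
(* The exponent is positive because q > 1 / (2 b^2); this makes the power vanish when z = 0, outside
   the ball. *)
have p0 : 0 < p t by move: q0; rewrite /q pmulr_lgt0// invr_gt0.
set z := pos_part _ in Q1 *.
have zub : z `^ p t <= expR (- (q t * x)).
  rewrite /z /pos_part; case: (ltP (x / a t ^+ 2) 1) => [y1|y1].
    rewrite max_l; last lra.
    have y01 : 0 <= x / a t ^+ 2 < 1 by rewrite y1 divr_ge0// ltW.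
    have /andP[_] := powR_expR_bounds y01 (ltW p0).
    by rewrite /q mulrA [p t / _ * x]mulrAC.
  rewrite max_r; last lra.
  by rewrite powR0 ?gt_eqF// expR_ge0.
have Gub : z `^ p t * Q <= expR (- (q t * x)).
  by apply: le_trans zub; rewrite ler_piMr// powR_ge0.
have G0 : 0 <= z `^ p t * Q by rewrite mulr_ge0// powR_ge0.
have GG0 := expR_gt0 (- (x / b ^+ 2)).
rewrite /ball/= ltr_norml; case: (lerP X x) => [Xx|xX].
  have qx : expR (- (q t * x)) <= e / 2.
    apply: le_trans eX; rewrite ler_expR lerN2.
    have : (2 * b ^+ 2)^-1 * X <= q t * x.
      by apply: ler_pM => //; [rewrite invr_ge0 mulr_ge0 ?(ltW b2)|exact:
        ltW|exact: ltW].
    by rewrite /X [_^-1 * _]mulrA mulVf ?mul1r// gt_eqF// mulr_gt0.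
  have bx : expR (- (x / b ^+ 2)) <= e / 2.
    apply: le_trans eX; rewrite ler_expR lerN2 ler_pdivlMr//.
    apply: le_trans Xx; rewrite /X (_ : _ * (2 / e) = 2 * (2 / e * b ^+ 2));
      last by ring.
    by rewrite ler_peMl ?ler1n// mulr_ge0 ?divr_ge0 ?(ltW b2) ?(ltW e0).
  by lra.
have y1 : x / a t ^+ 2 < 1.
  by apply: le_lt_trans h3; rewrite ler_pM2r ?invr_gt0// ltW.
have y0 : 0 <= x / a t ^+ 2 by rewrite divr_ge0// ltW.
have zE : z = 1 - x / a t ^+ 2 by rewrite /z /pos_part max_l//; lra.
have z1 : z `^ p t <= 1.
  by apply: le_trans zub _; rewrite expR_le1 oppr_le0 mulr_ge0// ltW.
have zlb : expR (- (r t * x)) <= z `^ p t.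
  have y01 : 0 <= x / a t ^+ 2 < 1 by rewrite y0.
  have /andP[+ _] := powR_expR_bounds y01 (ltW p0); rewrite -zE.
  apply: le_trans; rewrite ler_expR lerN2 /r.
  rewrite (_ : p t * _ / _ = q t * x * (1 - x / a t ^+ 2)^-1);
    last by rewrite zE /q; ring.
  rewrite [q t / _ * x]mulrAC; apply: ler_wpM2l.
    by rewrite mulr_ge0// ltW.
  rewrite lef_pV2 ?posrE ?subr_gt0// lerD2l lerN2.
  by rewrite ler_pM2r ?invr_gt0// ltW.
have Q3 : 1 - e / 4 <= Q.
  apply: le_trans Q1; rewrite lerD2l lerN2; apply: le_trans (ltW h7).
  apply: ler_wpM2l; first by rewrite mulr_ge0// ltW.
  have e1 : (1 - z) * gamma t = x * (gamma t / a t ^+ 2) by rewrite zE; field;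
    rewrite gt_eqF.
  have ga2 : 0 <= gamma t / a t ^+ 2 by rewrite divr_ge0 ?(ltW a2) ?(ltW ga0).
  have ib : 0 < b ^- 2 + 1 by rewrite addr_gt0// invr_gt0.
  rewrite e1 /B; apply: ge0_ler_powR; rewrite ?nnegrE ?(ltW k0)//.
  - by rewrite mulr_ge0.
  - by rewrite mulr_ge0 ?(ltW X0) ?(ltW ib).
  - by apply: ler_pM => //; exact: ltW.
have Glb : z `^ p t - e / 4 <= z `^ p t * Q.
  apply: le_trans (ler_wpM2l (powR_ge0 z (p t)) Q3).
  by rewrite mulrBr mulr1 lerD2l lerN2 ler_piMl// divr_ge0// ltW.
have xe : forall c : R, `|c - b ^- 2| < e / 4 / X -> `|c * x - x / b ^+ 2| <=
  e / 4.
  move=> c; rewrite ltr_pdivlMr// => hc.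
  rewrite (_ : c * x - x / b ^+ 2 = (c - b ^- 2) * x); last by ring.
  rewrite normrM (ger0_norm x0); apply: le_trans (ltW hc).
  by apply: ler_wpM2l => //; exact: ltW.
have l1 : expR (- (q t * x)) - expR (- (x / b ^+ 2)) <= e / 4.
  by apply: le_trans (xe _ h5); apply: expRN_lipschitz; rewrite mulr_ge0// ltW.
have l2 : expR (- (x / b ^+ 2)) - expR (- (r t * x)) <= e / 4.
  apply: le_trans (xe _ h6); rewrite distrC; apply: expRN_lipschitz.
  by rewrite divr_ge0// ltW.
by lra.
Unshelve. all: by end_near. Qed.

(** * Symmetry in beta and gamma, and the theorem *)

Lemma hyp2F1C {R : realType} (u v w z : R) : hyp2F1 u v w z = hyp2F1 v u w z.
Proof.
rewrite /hyp2F1; suff -> : hyp2F1_coeff u v w z = hyp2F1_coeff v u w z by [].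
apply/funext => n; rewrite /hyp2F1_coeff.
by rewrite [pochhammer u n * _]mulrC.
Qed.

Lemma gauss_hyp_covC {R : realType} (d : nat) (a alpha beta gamma : R) :
  gauss_hyp_cov d a alpha beta gamma = gauss_hyp_cov d a alpha gamma beta.
Proof.
apply/funext => h; rewrite /gauss_hyp_cov.
have -> : gamma - alpha + beta - d%:R / 2 = beta - alpha + gamma - d%:R / 2.
  by ring.
by rewrite hyp2F1C [Gamma (beta - d%:R / 2) * _]mulrC.
Qed.

(* The joint limit is taken along an arbitrary filter F on a parameter type T,
   which covers sequences, nets and the eps-delta reading of the limit. *)
Theorem theorem16 (R : realType) (d : nat) (alpha b : R) (d_ge1 : (1 <= d)%N)
    (alpha_gt : d%:R / 2 < alpha) (b_gt0 : 0 < b)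
    (T : Type) (F : set_system T) (FF : Filter F) (a beta gamma : T -> R)
    (params : \forall t \near F, hyp_params d alpha (beta t) (gamma t))
    (a_oo : a t @[t --> F] --> +oo) :
  (beta t @[t --> F] --> alpha -> gamma t @[t --> F] --> +oo ->
   a t / Num.sqrt (gamma t) @[t --> F] --> b ->
   {uniform, gauss_hyp_cov d (a t) alpha (beta t) (gamma t) @[t --> F]
      --> gaussian_cov d b})
  /\
  (gamma t @[t --> F] --> alpha -> beta t @[t --> F] --> +oo ->
   a t / Num.sqrt (beta t) @[t --> F] --> b ->
   {uniform, gauss_hyp_cov d (a t) alpha (beta t) (gamma t) @[t --> F]
      --> gaussian_cov d b}).
Proof.
split=> [betac gammay agc|gammac betay abc].
  exact: gauss_hyp_cov_cvg.
(* The second limit is the first with beta and gamma exchanged; the conditions of [hyp_params] are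
   symmetric in them. *)
under eq_fun do rewrite gauss_hyp_covC.
apply: gauss_hyp_cov_cvg => //;
  apply: filterS params => t [[al0 be0 ga0] dal h1 h2].
by split=> //; [rewrite mulrAC|rewrite [gamma t + _]addrC].
Qed.
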